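(* Let $R$ be a commutative Noetherian ring of prime characteristic $p$ and let $\mathfrak{a}$ be a proper ideal of $R$. Suppose that $(\mathfrak{a}_n)_{n\in\mathbb{N}_0}$ is an $f$-sequence of ideals of $R$ such that $\mathfrak{a}^{[p^n]}\subseteq\mathfrak{a}_n\subseteq(\mathfrak{a}^{[p^n]})^*$ for all $n\in\mathbb{N}_0$, and that the ideal $\mathfrak{A}$ of $R^{\infty}$ to which $(\mathfrak{a}_n)_{n\in\mathbb{N}_0}$ corresponds has a primary decomposition, so that the set $\bigcup_{n\in\mathbb{N}_0}\operatorname{ass}\mathfrak{a}_n$ is finite. Let the members of the latter set be $\mathfrak{p}_1,\ldots,\mathfrak{p}_t$. For each $i=1,\ldots,t$, let ${}^{e_i}$ and ${}^{c_i}$ stand for extension and contraction of ideals with respect to the natural ring homomorphism $R\to R_{\mathfrak{p}_i}$. (i) There exists a positive integer $h$ such that, for each $n\in\mathbb{N}_0$, $$\mathfrak{a}_n=\bigcap_{i=1}^t\big((\mathfrak{a}_n+\mathfrak{p}_i^{h[p^n]})^F\big)^{e_ic_i},$$ where $\big((\mathfrak{a}_n+\mathfrak{p}_i^{h[p^n]})^F\big)^{e_ic_i}$ is $\mathfrak{p}_i$-primary for $i=1,\ldots,t$, is a primary decomposition in which each primary component is $F$-closed. (ii) Assume that $R$ has a $p^{m_0}$-weak test element, for some $m_0\in\mathbb{N}_0$. Then, with $h$ as in (i): (a) for each $n\in\mathbb{N}_0$, $$(\mathfrak{a}^{[p^n]})^*=\bigcap_{i=1}^t\big(((\mathfrak{a}+\mathfrak{p}_i^h)^{[p^n]})^*\big)^{e_ic_i},$$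 where $\big(((\mathfrak{a}+\mathfrak{p}_i^h)^{[p^n]})^*\big)^{e_ic_i}$ is $\mathfrak{p}_i$-primary for $i=1,\ldots,t$, is a primary decomposition in which each primary component is $F$-closed, and the ideal of $R^{\infty}$ to which the $f$-sequence $\big((\mathfrak{a}^{[p^n]})^*\big)_{n\in\mathbb{N}_0}$ corresponds has a primary decomposition; (b) the $f$-sequence $\big((\mathfrak{a}^{[p^n]})^*\big)_{n\in\mathbb{N}_0}$ has $h$-linear growth of primary decompositions, and the set $\bigcup_{n\in\mathbb{N}_0}\operatorname{ass}(\mathfrak{a}^{[p^n]})^*$ is finite; and (c) $\bigcup_{n\in\mathbb{N}_0}\operatorname{ass}(\mathfrak{a}^{[p^n]})^*\subseteq\bigcup_{n\in\mathbb{N}_0}\operatorname{ass}\mathfrak{a}_n$. (iii) If $R$ has a locally stable $p^{m_0}$-weak test element, for some $m_0\in\mathbb{N}_0$, then, for each $n\in\mathbb{N}_0$, and with $h$ as in (i), $$(\mathfrak{a}^{[p^n]})^*=\bigcap_{i=1}^t\big((((\mathfrak{a}+\mathfrak{p}_i^h)^{[p^n]})^{e_i})^*\big)^{c_i},$$ where $\big((((\mathfrak{a}+\mathfrak{p}_i^h)^{[p^n]})^{e_i})^*\big)^{c_i}$ is $\mathfrak{p}_i$-primary for $i=1,\ldots,t$, is a primary decomposition in which each primary component is tightly closed.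
   Context: Rings have identity; $\mathbb{N}_0$ is the set of non-negative integers. $f:R\to R$, $r\mapsto r^p$, is the Frobenius homomorphism. For an ideal $\mathfrak{b}$, $\mathfrak{b}^{[p^n]}$ is the ideal generated by all $p^n$-th powers of elements of $\mathfrak{b}$, and $\mathfrak{b}^{h[p^n]}=(\mathfrak{b}^h)^{[p^n]}=(\mathfrak{b}^{[p^n]})^h$. The $F$-closure of an ideal $\mathfrak{b}$ of $R$ is $\mathfrak{b}^F=\{r\in R: r^{p^n}\in\mathfrak{b}^{[p^n]}\text{ for some }n\in\mathbb{N}_0\}$; $\mathfrak{b}$ is $F$-closed if $\mathfrak{b}=\mathfrak{b}^F$. For a commutative Noetherian ring $A$ of characteristic $p$, $A^{\circ}$ is the complement in $A$ of the union of the minimal primes of $A$. The tight closure $\mathfrak{b}^*$ of an ideal $\mathfrak{b}$ of $A$ is the ideal of all $r\in A$ for which there exists $c\in A^{\circ}$ with $cr^{p^n}\in\mathfrak{b}^{[p^n]}$ for all $n\gg0$; $\mathfrak{b}$ is tightly closed if $\mathfrak{b}=\mathfrak{b}^*$. A $p^{m_0}$-weak test element for $A$ is an element $c\in A^{\circ}$ such that, for every ideal $\mathfrak{b}$ of $A$ and every $r\in A$, one has $r\in\mathfrak{b}^*$ if and only if $cr^{p^n}\in\mathfrak{b}^{[p^n]}$ for all $n\ge m_0$. It is locally stable if, for each $\mathfrak{p}\in\operatorname{Spec}(A)$, its image in $A_{\mathfrak{p}}$ is a $p^{m_0}$-weak test element for $A_{\mathfrak{p}}$. Perfect closure: a ring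 of characteristic $p$ is perfect if its Frobenius homomorphism is bijective. $R^{\infty}$ is the perfect closure of $R$: a perfect commutative ring with a ring homomorphism $\psi_0:R\to R^{\infty}$ that is universal for ring homomorphisms from $R$ to perfect commutative rings of characteristic $p$. One has $\ker\psi_0=\sqrt{(0)}$, and each $\alpha\in R^\infty$ satisfies $\alpha^{p^m}\in\psi_0(R)$ for some $m\ge 0$. Put $\overline{r}=\psi_0(r)$, let $\overline{r}^{1/p^n}$ be its unique $p^n$-th root in $R^{\infty}$, and let $\psi_n:R\to R^{\infty}$ be the ring homomorphism $\psi_n(r)=\overline{r}^{1/p^n}$. An $f$-sequence of ideals of $R$ is a sequence $(\mathfrak{a}_n)_{n\in\mathbb{N}_0}$ of ideals of $R$ with $f^{-1}(\mathfrak{a}_{n+1})=\mathfrak{a}_n$ for all $n$. The map $\mathfrak{A}\mapsto(\psi_n^{-1}(\mathfrak{A}))_{n\in\mathbb{N}_0}$ is a bijection from the set of ideals of $R^{\infty}$ to the set of $f$-sequences of ideals of $R$, with inverse $(\mathfrak{a}_n)_n\mapsto\bigcup_n\psi_n(\mathfrak{a}_n)$; ''corresponds'' refers to this bijection. The sequence $\big((\mathfrak{a}^{[p^n]})^*\big)_{n\in\mathbb{N}_0}$ is an $f$-sequence. An ideal of a (not necessarily Noetherian) commutative ring has a primary decomposition if it is an intersection of finitely many primary ideals. For an ideal $\mathfrak{b}$ of $R$, $\operatorname{ass}\mathfrak{b}$ is the set of associated primes of $\mathfrak{b}$, i.e. the radicals of the components of a minimal primary decomposition of $\mathfrak{b}$.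 An $f$-sequence $(\mathfrak{a}_n)_n$ of proper ideals of $R$ has $h$-linear growth of primary decompositions ($h$ a positive integer) if for every $n\in\mathbb{N}_0$ there is a minimal primary decomposition $\mathfrak{a}_n=\mathfrak{q}_{1,n}\cap\cdots\cap\mathfrak{q}_{k_n,n}$ with $\big((\sqrt{\mathfrak{q}_{i,n}})^{[p^n]}\big)^h\subseteq\mathfrak{q}_{i,n}$ for all $i=1,\ldots,k_n$. *)

(* Defs.v *)
From HB Require Import structures.
From mathcomp Require Import all_boot all_order all_algebra.
From mathcomp Require Import boolp classical_sets cardinality.

Set Implicit Arguments.
Unset Strict Implicit.
Unset Printing Implicit Defensive.

Import GRing.Theory.
Local Open Scope classical_set_scope.
Local Open Scope ring_scope.

(* Ideals are Prop-valued sets: the library's [idealr] is a boolean predicate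
   and only covers proper ideals. *)

Definition is_ideal (R : comNzRingType) (I : set R) : Prop :=
  [/\ I 0, (forall x y, I x -> I y -> I (x + y))
    & forall r x, I x -> I (r * x)].

Definition is_proper_ideal (R : comNzRingType) (I : set R) : Prop :=
  is_ideal I /\ I <> setT.

Definition ideal_gen (R : comNzRingType) (X : set R) : set R :=
  smallest (@is_ideal R) X.

Definition noetherian (R : comNzRingType) : Prop :=
  forall I : set R, is_ideal I -> exists s : seq R, I = ideal_gen [set` s].

Definition ideal_add (R : comNzRingType) (I J : set R) : set R :=
  [set x + y | x in I & y in J].

Definition ideal_exp (R : comNzRingType) (I : set R) (h : nat) : set R :=
  ideal_gen [set \prod_(i < h) x i | x in [set x : 'I_h -> R | forall i, I (x i)]].

Definition radical (R : comNzRingType) (I : set R) : set R :=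
  [set x | exists n : nat, I (x ^+ n)].

Definition is_prime (R : comNzRingType) (P : set R) : Prop :=
  is_proper_ideal P /\ forall x y, P (x * y) -> P x \/ P y.

Definition minimal_prime (R : comNzRingType) (P : set R) : Prop :=
  is_prime P /\ forall Q : set R, is_prime Q -> Q `<=` P -> Q = P.

Definition extension (R S : comNzRingType) (phi : {rmorphism R -> S})
    (I : set R) : set S :=
  ideal_gen (phi @` I).

Definition contraction (R S : comNzRingType) (phi : {rmorphism R -> S})
    (J : set S) : set R :=
  phi @^-1` J.

(* [phi] is the natural homomorphism from R to (a model of) the localization
   of R at the prime ideal [P]. *)
Definition is_localization (R L : comNzRingType) (P : set R)
    (phi : {rmorphism R -> L}) : Prop :=
  [/\ (forall s, ~ P s -> exists u, phi s * u = 1),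
      (forall y, exists r s, ~ P s /\ y * phi s = phi r)
    & forall r, phi r = 0 -> exists s, ~ P s /\ s * r = 0].

Definition is_primary (R : comNzRingType) (Q : set R) : Prop :=
  is_proper_ideal Q /\ forall x y, Q (x * y) -> Q x \/ radical Q y.

Definition is_primary_to (R : comNzRingType) (P Q : set R) : Prop :=
  is_primary Q /\ radical Q = P.

(* The radicals need not be distinct and components may be redundant. *)
Definition primary_decomposition (R : comNzRingType) (I : set R) (k : nat)
    (q : 'I_k -> set R) : Prop :=
  (forall i, is_primary (q i)) /\ I = \bigcap_i q i.

Definition has_primary_decomposition (R : comNzRingType) (I : set R) : Prop :=
  exists k (q : 'I_k -> set R), primary_decomposition I q.

Definition minimal_primary_decomposition (R : comNzRingType) (I : set R)
    (k : nat) (q : 'I_k -> set R) : Prop :=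
  [/\ primary_decomposition I q,
      injective (fun i => radical (q i))
    & forall j, ~ (\bigcap_(i in [set i | i <> j]) q i `<=` q j)].

Definition ass (R : comNzRingType) (I : set R) : set (set R) :=
  [set P | exists k (q : 'I_k -> set R),
     minimal_primary_decomposition I q /\ exists i, P = radical (q i)].

Section CharacteristicP.
Variable p : nat.

Definition frob_power (R : comNzRingType) (n : nat) (I : set R) : set R :=
  ideal_gen [set x ^+ (p ^ n) | x in I].

Definition F_closure (R : comNzRingType) (I : set R) : set R :=
  [set r | exists n : nat, frob_power n I (r ^+ (p ^ n))].

Definition F_closed (R : comNzRingType) (I : set R) : Prop := I = F_closure I.

(* The complement of the union of the minimal primes. *)
Definition ring_circ (R : comNzRingType) : set R :=
  ~` \bigcup_(P in [set P : set R | minimal_prime P]) P.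

Definition tight_closure (R : comNzRingType) (I : set R) : set R :=
  [set r | exists2 c, ring_circ c &
     exists N : nat, forall n : nat, (N <= n)%N ->
       frob_power n I (c * r ^+ (p ^ n))].

Definition tightly_closed (R : comNzRingType) (I : set R) : Prop :=
  I = tight_closure I.

(* [c] is a p^m0-weak test element. *)
Definition weak_test_element (R : comNzRingType) (m0 : nat) (c : R) : Prop :=
  ring_circ c /\
  forall I : set R, is_ideal I -> forall r : R,
    tight_closure I r <->
    forall n : nat, (m0 <= n)%N -> frob_power n I (c * r ^+ (p ^ n)).

Definition locally_stable_weak_test_element (R : comNzRingType) (m0 : nat)
    (c : R) : Prop :=
  weak_test_element m0 c /\
  forall P : set R, is_prime P ->
  forall (L : comNzRingType) (phi : {rmorphism R -> L}),
    is_localization P phi -> weak_test_element m0 (phi c).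

Definition f_sequence (R : comNzRingType) (a : nat -> set R) : Prop :=
  (forall n, is_ideal (a n)) /\
  forall n, (fun r : R => r ^+ p) @^-1` (a n.+1) = a n.

Definition linear_growth (R : comNzRingType) (h : nat) (a : nat -> set R) :
    Prop :=
  [/\ f_sequence a, (forall n, is_proper_ideal (a n))
    & forall n, exists k (q : 'I_k -> set R),
        minimal_primary_decomposition (a n) q /\
        forall i, ideal_exp (frob_power n (radical (q i))) h `<=` q i].

Definition perfect (S : comNzRingType) : Prop :=
  p \in [pchar S] /\ bijective (fun x : S => x ^+ p).

Definition is_perfect_closure (R Rinf : comNzRingType)
    (psi0 : {rmorphism R -> Rinf}) : Prop :=
  perfect Rinf /\
  forall (S : comNzRingType) (f : {rmorphism R -> S}), perfect S ->
    exists g : {rmorphism Rinf -> S},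
      g \o psi0 =1 f /\
      forall g' : {rmorphism Rinf -> S}, g' \o psi0 =1 f -> g' =1 g.

(* The p^n-th root of psi0 r, which exists and is unique as soon as Rinf is
   perfect; the default value 0 is then irrelevant. *)
Definition psi (R Rinf : comNzRingType) (psi0 : {rmorphism R -> Rinf})
    (n : nat) (r : R) : Rinf :=
  xget 0 [set x : Rinf | x ^+ (p ^ n) = psi0 r].

(* The ideal of Rinf to which the f-sequence [a] corresponds. *)
Definition f_sequence_ideal (R Rinf : comNzRingType)
    (psi0 : {rmorphism R -> Rinf}) (a : nat -> set R) : set Rinf :=
  \bigcup_n (psi psi0 n @` a n).

End CharacteristicP.

(* Main.v *)
(** The ideals psi_n^-1(Q_j), for Q_j the components of a minimal primary
    decomposition of the ideal of the perfect closure, are primary with radical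
    psi_0^-1(sqrt Q_j) independent of n, form f-sequences in n, and cut out a_n.
    If p_i^h lies in the component at n = 0, then p_i^(h[p^n]) lies in the
    component at n, so saturating the F-closure of a_n + p_i^(h[p^n]) gives
    p_i-primary ideals between a_n and these components: this is (i).
    For (ii) and (iii), let c be a test element and r an element of all the
    (local or global) tight closures on the right-hand side.  Then c r^(p^m)
    lies in the components of a_(n+m) given by (i) for every m >= m0, hence in
    (a^[p^(n+m)])^*, and one more application of c gives
    c^(1 + p^m0) r^(p^(m+m0)) in a^[p^(n+m+m0)], so r is in (a^[p^n])^*.
    The components stay inside p_i because primes of a Noetherian ring are
    tightly closed, by Krull's intersection theorem in R_(p_i). *)
Require Import Defs.
From HB Require Import structures.
From mathcomp Require Import all_boot all_order all_algebra.
From mathcomp Require Import boolp classical_sets cardinality functions.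
From mathcomp Require Import generic_quotient ring_quotient.

Set Implicit Arguments.
Unset Strict Implicit.
Unset Printing Implicit Defensive.

Import GRing.Theory.
Local Open Scope classical_set_scope.
Local Open Scope ring_scope.

(** * Ideals, radicals, prime and primary ideals in an arbitrary commutative ring; primes obtained
    from Zorn's lemma *)

Section Ideals.
Variable R : comNzRingType.
Implicit Types (I J Q P X T : set R) (s : seq R).

Lemma idealB I x y : is_ideal I -> I x -> I y -> I (x - y).
Proof. by case=> _ D M Ix Iy; apply: D => //; rewrite -mulN1r; apply: M. Qed.

Lemma ideal_mulr I x y : is_ideal I -> I x -> I (x * y).
Proof. by case=> _ _ M Ix; rewrite mulrC; apply: M. Qed.

Lemma ideal_gen_ideal X : is_ideal (ideal_gen X).
Proof.
split.
- by move=> M [] [].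
- by move=> x y genx geny M MX; case: (MX) => [] [_ D _ _]; apply: D;
    [apply: genx|apply: geny].
- by move=> r x genx M MX; case: (MX) => [] [_ _ Mr _]; apply: Mr; apply: genx.
Qed.

Lemma sub_ideal_gen X : X `<=` ideal_gen X.
Proof. exact: sub_smallest. Qed.

Lemma ideal_gen_sub X I : is_ideal I -> X `<=` I -> ideal_gen X `<=` I.
Proof. exact: smallest_sub. Qed.

Lemma setI_ideal I J : is_ideal I -> is_ideal J -> is_ideal (I `&` J).
Proof.
move=> [I0 ID IM] [J0 JD JM]; split=> //.
- by move=> x y [Ix Jx] [Iy Jy]; split; [apply: ID|apply: JD].
- by move=> r x [Ix Jx]; split; [apply: IM|apply: JM].
Qed.

Lemma colon_ideal I x : is_ideal I -> is_ideal [set y | I (x * y)].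
Proof.
move=> [I0 ID IM]; split => /=.
- by rewrite mulr0.
- by move=> y z Iy Iz; rewrite mulrDr; apply: ID.
- by move=> r y Iy; rewrite mulrCA; apply: IM.
Qed.

Lemma ideal_add_ideal I J : is_ideal I -> is_ideal J -> is_ideal (ideal_add I J).
Proof.
move=> [I0 ID IM] [J0 JD JM]; split.
- by exists 0 => //; exists 0 => //; rewrite addr0.
- move=> _ _ [x Ix [y Jy <-]] [x' Ix' [y' Jy' <-]].
  by exists (x + x'); [exact: ID|exists (y + y'); [exact: JD|rewrite addrACA]].
- move=> r _ [x Ix [y Jy <-]].
  by exists (r * x); [exact: IM|exists (r * y); [exact: JM|rewrite mulrDr]].
Qed.

Lemma ideal_add_subl I J : is_ideal J -> I `<=` ideal_add I J.
Proof. by case=> J0 _ _ x Ix; exists x => //; exists 0 => //; rewrite addr0. Qed.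

Lemma ideal_add_subr I J : is_ideal I -> J `<=` ideal_add I J.
Proof. by case=> I0 _ _ x Jx; exists 0 => //; exists x => //; rewrite add0r. Qed.

Lemma ideal_add_sub I J Q : is_ideal Q -> I `<=` Q -> J `<=` Q -> ideal_add I J `<=` Q.
Proof. by case=> _ D _ IQ JQ _ [x /IQ Qx [y /JQ Qy <-]]; apply: D. Qed.

Lemma ideal_add_mono I J I' J' :
  I `<=` I' -> J `<=` J' -> ideal_add I J `<=` ideal_add I' J'.
Proof. by move=> II' JJ' _ [x /II' ? [y /JJ' ? <-]]; exists x => //; exists y. Qed.

Lemma principal_ideal x : is_ideal [set r * x | r in [set: R]].
Proof.
split.
- by exists 0 => //; rewrite mul0r.
- by move=> _ _ [r _ <-] [r' _ <-]; exists (r + r') => //; rewrite mulrDl.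
- by move=> z _ [r _ <-]; exists (z * r) => //; rewrite mulrA.
Qed.

Lemma proper_idealP I : is_ideal I -> (I <> setT) <-> ~ I 1.
Proof.
move=> Iid; split=> [IT I1|I1 IT]; last by apply: I1; rewrite IT.
by apply: IT; apply/seteqP; split=> // x _; rewrite -[x]mulr1; case: Iid => _ _; apply.
Qed.

Lemma radical_ideal I : is_ideal I -> is_ideal (radical I).
Proof.
move=> [I0 ID IM]; split.
- by exists 1%N; rewrite expr1.
- move=> x y [m Im] [n In]; exists (m + n)%N; rewrite exprDn.
  apply: (big_ind I) => // i _; rewrite -mulr_natl; apply: (IM).
  (* In each binomial term either the exponent of [y] is at least [n] or that of [x] is at least
     [m]. *)
  have [lein|ltni] := leqP n i.
    by rewrite -(subnK lein) exprD mulrA; apply: IM.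
  rewrite mulrC; have lem : (m <= m + n - i)%N by rewrite -addnBA ?leq_addr // ltnW.
  by rewrite -(subnK lem) exprD mulrA; apply: IM.
- by move=> r x [n In]; exists n; rewrite exprMn; apply: IM.
Qed.

Lemma sub_radical I : I `<=` radical I.
Proof. by move=> x Ix; exists 1%N; rewrite expr1. Qed.

Lemma radical_mono I J : I `<=` J -> radical I `<=` radical J.
Proof. by move=> IJ x [n /IJ Jx]; exists n. Qed.

Lemma radical_setI I J : is_ideal I -> is_ideal J ->
  radical (I `&` J) = radical I `&` radical J.
Proof.
move=> [_ _ IM] [_ _ JM]; apply/seteqP; split=> [x [n [In Jn]]|x [[m Im] [n Jn]]].
  by split; exists n.
by exists (m + n)%N; split; rewrite exprD; [rewrite mulrC; apply: IM|apply: JM].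
Qed.

Lemma prime_ideal P : is_prime P -> is_ideal P.
Proof. by case=> [[]]. Qed.

Lemma prime1 P : is_prime P -> ~ P 1.
Proof. by case=> [[Pid PT] _]; apply/proper_idealP. Qed.

Lemma primeX P x n : is_prime P -> P (x ^+ n) -> P x.
Proof.
move=> Ppr; elim: n => [/(prime1 Ppr)//|n IHn].
by rewrite exprS; case: Ppr => _ PM /PM [].
Qed.

Lemma prime_notM P x y : is_prime P -> ~ P x -> ~ P y -> ~ P (x * y).
Proof. by move=> [_ PM] nx ny /PM []. Qed.

Lemma prime_notX P x n : is_prime P -> ~ P x -> ~ P (x ^+ n).
Proof. by move=> Ppr nx /(primeX Ppr). Qed.

Lemma primary_ideal Q : is_primary Q -> is_ideal Q.
Proof. by case=> [[]]. Qed.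

Lemma primary1 Q : is_primary Q -> ~ Q 1.
Proof. by case=> [[Qid QT] _]; apply/proper_idealP. Qed.

Lemma radical_primary_prime Q : is_primary Q -> is_prime (radical Q).
Proof.
move=> Qpr; have Qid := primary_ideal Qpr; have Rid := radical_ideal Qid; split.
  by split=> //; apply/proper_idealP => // -[n]; rewrite expr1n; apply: primary1.
move=> x y [n]; rewrite exprMn; case: Qpr => _ /[apply] -[Qx|[m]].
  by left; exists n.
by rewrite -exprM => Qy; right; exists (n * m)%N.
Qed.

Lemma primary_setI Q Q' : is_primary Q -> is_primary Q' ->
  radical Q = radical Q' -> is_primary (Q `&` Q').
Proof.
move=> Qpr Q'pr eqr; have Qid := primary_ideal Qpr; have Q'id := primary_ideal Q'pr.
have Iid := setI_ideal Qid Q'id.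
split; first by split=> //; apply/proper_idealP => // -[/(primary1 Qpr)].
move=> x y [Qxy Q'xy]; rewrite radical_setI // -eqr setIid.
have [ry|nry] := pselect (radical Q y); [by right|left; split].
  by case: Qpr => _ /(_ _ _ Qxy) [].
by case: Q'pr => _ /(_ _ _ Q'xy) []; rewrite -?eqr.
Qed.

(** [T] is an arbitrary set: with [T = {1}] this yields maximal ideals, and in Krull's theorem below
    [T] consists of the multiples of one element by the elements outside a prime. *)
Lemma ideal_maximal_avoiding I T : is_ideal I -> I `&` T = set0 ->
  exists2 Q, [/\ is_ideal Q, I `<=` Q & Q `&` T = set0]
           & forall Q', is_ideal Q' -> Q `<=` Q' -> Q' `&` T = set0 -> Q' = Q.
Proof.
move=> Iid IT.
(* The empty chain has union [set0], hence the union with [I]. *)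
pose P := [set X | is_ideal (X `|` I) /\ (X `|` I) `&` T = set0].
have [F FP totF|A [[Aid AT] Amax]] := @Zorn_bigcup _ P.
  have UP (x : R) : (\bigcup_(X in F) X `|` I) x <->
      I x \/ exists2 X, F X & (X `|` I) x.
    split=> [[[X FX Xx]|Ix]|[Ix|[X FX [Xx|Ix]]]]; try by [left|right].
    - by right; exists X => //; left.
    - by left; exists X.
  split; last first.
    rewrite -subset0 => x [/UP [Ix|[X FX Xx]] Tx]; first by rewrite -IT.
    by case: (FP X FX) => _ <-.
  split.
  - by apply/UP; left; case: Iid.
  - move=> x y /UP Ux /UP Uy; apply/UP.
    case: Ux => [Ix|[X FX Xx]]; case: Uy => [Iy|[Y FY Yy]].
    + by left; case: Iid => _ + _; apply.
    + by right; exists Y => //; case: (FP Y FY) => -[_ + _] _; apply=> //; right.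
    + by right; exists X => //; case: (FP X FX) => -[_ + _] _; apply=> //; right.
    + right; case: (totF X Y FX FY) => [XY|YX].
        exists Y => //; case: (FP Y FY) => -[_ + _] _; apply=> //.
        by case: Xx => [/XY|]; [left|right].
      exists X => //; case: (FP X FX) => -[_ + _] _; apply=> //.
      by case: Yy => [/YX|]; [left|right].
  - move=> r x /UP [Ix|[X FX Xx]]; apply/UP; [left|right].
      by case: Iid => _ _; apply.
    by exists X => //; case: (FP X FX) => -[_ _ +] _; apply.
have sAI : A `|` I `<=` A.
  apply: contrapT => nsub; apply: (Amax (A `|` I)).
    by split=> //; move=> x Ax; left.
  by rewrite /P /= -setUA setUid.
have AI : A `|` I = A by apply/seteqP; split=> // x; left.
rewrite AI in Aid AT.
exists A; first by split=> // x Ix; rewrite -AI; right.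
move=> Q' Q'id AQ' Q'T; apply: contrapT => neq; apply: (Amax Q').
  by split=> // Q'A; apply: neq; apply/seteqP.
have Q'I : Q' `|` I = Q'.
  by apply/seteqP; split=> [x [//|Ix]|x]; [apply: AQ'; rewrite -AI; right|left].
by rewrite /P /= Q'I.
Qed.

(** An ideal [Q] maximal among those avoiding 1 is prime: if [x] lies outside [Q], then 1 lies in
    [Q + (x)], and multiplying by [y] puts [y] in [Q] as soon as [x * y] is there. *)
Lemma exists_prime_above I : is_proper_ideal I -> exists2 P, is_prime P & I `<=` P.
Proof.
move=> [Iid IT]; have I1 : ~ I 1 by apply/proper_idealP.
have [|Q [Qid IQ Q1] Qmax] := @ideal_maximal_avoiding I [set 1] Iid.
  by rewrite -subset0 => _ [/[swap] -> /I1].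
have nQ1 : ~ Q 1 by move=> Q1'; have : (Q `&` [set 1]) 1 by []; rewrite Q1.
exists Q => //; split; first by split=> //; apply/proper_idealP.
move=> x y Qxy; have [Qx|nQx] := pselect (Q x); [by left|right].
pose Q' := ideal_add Q [set r * x | r in [set: R]].
have Q'id : is_ideal Q' := ideal_add_ideal Qid (principal_ideal x).
have [q Qq [_ [r _ <-] q1]] : Q' 1.
  apply: contrapT => nQ'1; apply: nQx; rewrite -(Qmax Q') //.
  - by apply: ideal_add_subr => //; exists 1; rewrite ?mul1r.
  - by apply: ideal_add_subl; apply: principal_ideal.
  - by rewrite -subset0 => _ [/[swap] -> /nQ'1].
rewrite -[y]mul1r -q1 mulrDl; case: (Qid) => _ D M; apply: D; first exact: ideal_mulr.
by rewrite -mulrA; apply: M.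
Qed.

Lemma minimal_prime_below P : is_prime P -> exists2 P0, minimal_prime P0 & P0 `<=` P.
Proof.
move=> Ppr.
(* Zorn's lemma provides maximal elements, hence the complements in [P]. *)
pose C := [set X | X `<=` P /\ is_prime (P `\` X)].
have [F FC' totF|A [[AP Apr] Amax]] := @Zorn_bigcup _ C.
  have FC X : F X -> is_prime (P `\` X) by case/FC'.
  have UP (x : R) : (P `\` \bigcup_(X in F) X) x <-> P x /\ forall X, F X -> (P `\` X) x.
    split=> [[Px nF]|[Px nF]]; first by split=> // X FX; split=> // Xx; apply: nF; exists X.
    by split=> // -[X FX Xx]; case: (nF X FX).
  have PX x X : F X -> (P `\` \bigcup_(X in F) X) x -> (P `\` X) x.
    by move=> FX /UP [_]; apply.
  have id : is_ideal (P `\` \bigcup_(X in F) X).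
    split.
    - apply/UP; split=> [|X /FC /prime_ideal []//].
      by case: (prime_ideal Ppr).
    - move=> x y Ux Uy; apply/UP; split=> [|X FX].
        by case: (prime_ideal Ppr) => _ + _; apply; [case: Ux|case: Uy].
      by case: (prime_ideal (FC X FX)) => _ + _; apply; apply: PX.
    - move=> r x Ux; apply/UP; split=> [|X FX].
        by case: (prime_ideal Ppr) => _ _; apply; case: Ux.
      by case: (prime_ideal (FC X FX)) => _ _; apply; apply: PX.
  split; first by move=> x [X /FC' [XP _] /XP].
  split; first by split=> //; apply/proper_idealP => // -[/(prime1 Ppr)].
  (* The intersection of a chain of primes is prime: two members of the chain exclude [x] and [y]
     respectively, and the smaller of these two primes excludes both although it contains
     [x * y]. *)
  move=> x y Uxy; apply: contrapT => /not_orP [nUx nUy].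
  have wit z : ~ (P `\` \bigcup_(X in F) X) z -> ~ P z \/ exists2 X, F X & ~ (P `\` X) z.
    move=> nU; have [Pz|] := pselect (P z); [right|by left].
    apply: contrapT => nX; apply: nU; apply/UP; split=> // X FX.
    by apply: contrapT => nz; apply: nX; exists X.
  have PF : forall Y, F Y -> ~ (P `\` Y) x -> ~ (P `\` Y) y -> False.
    by move=> Y FY nx ny; case: (FC Y FY) => _ /(_ _ _ (PX _ _ FY Uxy)) [].
  have sub X z : ~ P z -> ~ (P `\` X) z by move=> nPz [Pz _].
  have mono X Y z : X `<=` Y -> ~ (P `\` X) z -> ~ (P `\` Y) z.
    by move=> XY nX [Pz nY]; apply: nX; split=> // /XY.
  case: (wit _ nUx) => [nPx|[X FX nX]]; case: (wit _ nUy) => [nPy|[Y FY nY]].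
  + by case: Uxy => Pxy _; case: Ppr => _ /(_ _ _ Pxy) [].
  + by apply: (PF Y) => //; apply: sub.
  + by apply: (PF X) => //; apply: sub.
  + case: (totF X Y FX FY) => [XY|YX]; first by apply: (PF Y) => //; apply: mono nX.
    by apply: (PF X) => //; apply: mono nY.
exists (P `\` A); last by move=> x [].
split=> // Q Qpr QPA; apply: contrapT => neq; apply: (Amax (P `\` Q)).
  split=> [x Ax|AsubQ]; first by split; [exact: AP|move=> /QPA []].
  apply: neq; apply/seteqP; split=> // x [Px nAx]; apply: contrapT => nQ.
  by apply: nAx; apply: AsubQ.
split; first by move=> x [].
by rewrite setDD setIidr // => x /QPA [].
Qed.

End Ideals.

(** * Powers of ideals, finiteness in Noetherian rings, minimal primary decompositions and
    associated primes *)

Section NoetherianPrimary.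
Variable R : comNzRingType.
Implicit Types (I J Q P X T : set R) (s : seq R).

(** Each factor is reduced to generators in turn, because the elements that multiply a fixed one
    into [I] form an ideal. *)
Lemma ideal_gen_mul X Y I x y : is_ideal I ->
  (forall u v, X u -> Y v -> I (u * v)) ->
  ideal_gen X x -> ideal_gen Y y -> I (x * y).
Proof.
move=> Iid XYI Xx; apply: (ideal_gen_sub (colon_ideal x Iid)) => v Yv /=.
rewrite mulrC; apply: (ideal_gen_sub (colon_ideal v Iid)) Xx => u Xu /=.
by rewrite mulrC; apply: XYI.
Qed.

Lemma ideal_exp_ideal I h : is_ideal (ideal_exp I h).
Proof. exact: ideal_gen_ideal. Qed.

Lemma prod_ideal_exp I h (x : 'I_h -> R) :
  (forall i, I (x i)) -> ideal_exp I h (\prod_(i < h) x i).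
Proof. by move=> Ix; apply: sub_ideal_gen; exists x. Qed.

Lemma expr_ideal_exp I h x : I x -> ideal_exp I h (x ^+ h).
Proof.
move=> Ix; suff -> : x ^+ h = \prod_(i < h) x by apply: prod_ideal_exp.
by rewrite prodr_const card_ord.
Qed.

Lemma ideal_exp_sub I h : is_ideal I -> (0 < h)%N -> ideal_exp I h `<=` I.
Proof.
case: h => // h Iid _; apply: ideal_gen_sub => // _ [x Ix <-].
by rewrite big_ord_recl; apply: ideal_mulr => //; apply: Ix.
Qed.

Lemma ideal_exp_mulr I h x y : ideal_exp I h x -> I y -> ideal_exp I h.+1 (x * y).
Proof.
move=> + Iy; rewrite mulrC.
apply: (ideal_gen_sub (colon_ideal y (ideal_exp_ideal I h.+1))) => _ [z Iz <-] /=.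
pose z' (i : 'I_h.+1) := if unlift ord0 i is Some j then z j else y.
have -> : y * \prod_(i < h) z i = \prod_(i < h.+1) z' i.
  rewrite big_ord_recl /z' unlift_none; congr (_ * _).
  by apply: eq_bigr => i _; rewrite liftK.
by apply: prod_ideal_exp => i; rewrite /z'; case: unliftP.
Qed.

(** Pigeonhole on exponents: if [x ^+ M] is in [Q], a monomial of length at least [M + N] either
    contains [x] at least [M] times or keeps at least [N] factors from the other generators. *)
Lemma monomials_in_ideal Q s : is_ideal Q -> (forall x, x \in s -> radical Q x) ->
  exists N, forall m, {subset m <= s} -> (N <= size m)%N -> Q (\prod_(z <- m) z).
Proof.
move=> Qid; have [_ _ QM] := Qid.
elim: s => [|x s IHs] sQ.
  by exists 1%N => -[|y m] // /(_ y); rewrite mem_head => /(_ isT).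
have [y ys|N NP] := IHs; first by apply: sQ; rewrite inE ys orbT.
have [M QxM] := sQ x (mem_head _ _).
exists (M + N)%N => m ms lem; rewrite (bigID (pred1 x)) /=.
have [leM|ltM] := leqP M (count_mem x m).
  apply: ideal_mulr => //.
  rewrite (eq_bigr (fun=> x)) => [|z /eqP //]; rewrite big_const_seq iter_mulr_1.
  by rewrite -(subnK leM) exprD; apply: QM.
apply: QM; rewrite -big_filter; apply: NP.
  by move=> z; rewrite mem_filter => /andP[zx /ms]; rewrite inE (negPf zx).
rewrite size_filter; have := count_predC (pred1 x) m; rewrite /predC /= => e.
have {}e : (count (fun z => z != x) m + count_mem x m = size m)%N by rewrite -e addnC.
move: lem; rewrite -e => lem; rewrite -(leq_add2l M); apply: leq_trans lem _.
by rewrite addnC leq_add2r ltnW.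
Qed.

(** A product of [n] elements of [I] is a combination of monomials of length [n] in a finite
    generating set, and all long enough monomials lie in [Q]. *)
Lemma ideal_exp_sub_radical I Q : noetherian R -> is_ideal I -> is_ideal Q ->
  I `<=` radical Q -> exists h, forall n, (h <= n)%N -> ideal_exp I n `<=` Q.
Proof.
move=> noethR Iid Qid IQ; have [s Is] := noethR I Iid.
have [|N NP] := @monomials_in_ideal Q s Qid.
  by move=> x xs; apply: IQ; rewrite Is; apply: sub_ideal_gen.
exists N => n leNn; apply: ideal_gen_sub => // _ [x Ix <-].
pose M k := [set \prod_(z <- m) z | m in [set m : seq R | {subset m <= s} /\ size m = k]].
suff: ideal_gen (M n) (\prod_(i < n) x i).
  by apply: ideal_gen_sub => // _ [m [ms sm] <-]; apply: NP; rewrite ?sm.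
elim: n x Ix {leNn} => [|n IHn] x Ix.
  by rewrite big_ord0; apply: sub_ideal_gen; exists [::]; rewrite ?big_nil.
rewrite big_ord_recl mulrC.
have Ix0 := Ix ord0; rewrite /= Is in Ix0.
apply: (ideal_gen_mul (ideal_gen_ideal _) _ (IHn _ _) Ix0) => [_ v [m [ms sm] <-] vs|i] /=.
  apply: sub_ideal_gen; exists (v :: m); last by rewrite big_cons mulrC.
  by split; rewrite /= ?sm // => z; rewrite inE => /predU1P [->|/ms].
exact: Ix.
Qed.

Lemma chain_stabilizes (F : nat -> set R) : noetherian R ->
  (forall n, is_ideal (F n)) -> (forall n, F n `<=` F n.+1) ->
  exists m, forall n, F n `<=` F m.
Proof.
move=> noethR Fid FS.
have Fm m n : (m <= n)%N -> F m `<=` F n.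
  by elim: n => [|n IHn]; [rewrite leqn0 => /eqP->|
     rewrite leq_eqVlt => /predU1P [->//|/IHn mn] x /mn /FS].
have Uid : is_ideal (\bigcup_n F n).
  split.
  - by exists 0%N => //; case: (Fid 0%N).
  - move=> x y [m _ Fx] [n _ Fy]; exists (maxn m n) => //.
    by case: (Fid (maxn m n)) => _ + _; apply;
      [apply: Fm Fx; apply: leq_maxl|apply: Fm Fy; apply: leq_maxr].
  - by move=> r x [n _ Fx]; exists n => //; case: (Fid n) => _ _; apply.
have [s Us] := noethR _ Uid.
suff [m Fs] : exists m, forall x, x \in s -> F m x.
  exists m => n x Fx; suff: (\bigcup_n F n) x by rewrite Us; apply: ideal_gen_sub.
  by exists n.
have : forall x, x \in s -> (\bigcup_n F n) x by move=> x xs; rewrite Us; apply: sub_ideal_gen.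
elim: s {Us} => [|x s IHs] sU; first by exists 0%N.
have [y ys|m ms] := IHs; first by apply: sU; rewrite inE ys orbT.
have [n _ Fx] := sU x (mem_head _ _).
exists (maxn m n) => y; rewrite inE => /predU1P [->|/ms Fy].
  by apply: Fm Fx; apply: leq_maxr.
by apply: Fm Fy; apply: leq_maxl.
Qed.

Lemma radical_bigcap k (D : set 'I_k) (q : 'I_k -> set R) :
  (forall i, is_ideal (q i)) ->
  radical (\bigcap_(i in D) q i) = \bigcap_(i in D) radical (q i).
Proof.
move=> qid; apply/seteqP; split=> [x [n qx] i Di|x rx]; first by exists n; apply: qx.
(* The exponent is a dummy 0 outside [D]; the sum of all exponents then serves every [i] in [D] at
   once. *)
have /choice [n nP] (i : 'I_k) : exists n, D i -> q i (x ^+ n).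
  have [/rx [n qx]|nDi] := pselect (D i); first by exists n.
  by exists 0%N.
exists (\sum_i n i)%N => i Di; rewrite (bigD1 i) //= exprD.
by apply: ideal_mulr => //; apply: nP.
Qed.

(** If no [J i] with [i] in [D] equals [P], each contains an element outside [P]; the product of
    these elements lies in the intersection but not in [P]. *)
Lemma prime_eq_bigcap k (D : set 'I_k) (J : 'I_k -> set R) P : is_prime P ->
  (forall i, is_ideal (J i)) -> P = \bigcap_(i in D) J i -> exists2 i, D i & P = J i.
Proof.
move=> Ppr Jid PJ; apply: contrapT => nP.
have /choice [x xP] (i : 'I_k) : exists x, ~ P x /\ (D i -> J i x).
  have [Di|nDi] := pselect (D i); last by exists 1; split=> //; apply: prime1.
  have /existsNP [x /not_implyP [Jx nPx]] : ~ (J i `<=` P).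
    move=> JP; apply: nP; exists i => //; apply/seteqP; split=> // x.
    by rewrite PJ; apply.
  by exists x.
have : P (\prod_i x i).
  rewrite PJ => i Di; rewrite (bigD1 i) //=; apply: ideal_mulr => //.
  by case: (xP i) => _; apply.
apply: (big_ind (fun y => ~ P y)) => [|y z|i _]; first exact: prime1.
- exact: prime_notM.
- by case: (xP i).
Qed.

(** The colon by [x] discards the components containing [x] and leaves the radical of every other
    component unchanged. This expresses radicals of components through [I] alone. *)
Lemma colon_radical I k (q : 'I_k -> set R) x : primary_decomposition I q ->
  radical [set y | I (x * y)] = \bigcap_(i in [set i | ~ q i x]) radical (q i).
Proof.
move=> [qpr ->]; have qid i := primary_ideal (qpr i).
rewrite -radical_bigcap //; apply/seteqP; split=> y [n qxy].
  suff: (\bigcap_(i in [set i | ~ q i x]) radical (q i)) y by rewrite -radical_bigcap.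
  move=> i nqx; have /= := qxy i Logic.I; case: (qpr i) => _ /[apply] -[//|[m]].
  by rewrite -exprM; exists (n * m)%N.
exists n => i _ /=; have [qx|nqx] := pselect (q i x); first exact: ideal_mulr.
by have := qxy i nqx; case: (qid i) => _ _; apply.
Qed.

(* [G] lets a bound on the components survive the merging of components with
   the same radical. *)
Lemma exists_minimal_primary_decomposition (G : set (set R)) I k (q : 'I_k -> set R) :
  (forall Q, G Q -> is_primary Q) ->
  (forall Q Q', G Q -> G Q' -> radical Q = radical Q' -> G (Q `&` Q')) ->
  (forall i, G (q i)) -> I = \bigcap_i q i ->
  exists k' (q' : 'I_k' -> set R),
    minimal_primary_decomposition I q' /\ forall i, G (q' i).
Proof.
move=> Gpr GI Gq Iq.
pose S n := `[< exists q : 'I_n -> set R, (forall i, G (q i)) /\ I = \bigcap_i q i >].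
have Sk : exists n, S n by exists k; apply/asboolP; exists q.
(* A decomposition with the least number [k] of components from [G] is minimal: two components of
   equal radical could be merged and a redundant one dropped, and [lift j] enumerates the indices
   that remain. *)
case: (ex_minnP Sk) => {k q Gq Iq Sk} k /asboolP [q [Gq Iq]] kmin.
exists k, q; split=> //; split; first by split=> // i; apply: Gpr.
- move=> i j eqr; apply: contrapT => neq.
  case: k => [|k] in q Gq Iq kmin i j eqr neq *; first by case: i {eqr neq}.
  suff /kmin : S k by rewrite ltnn.
  apply/asboolP.
  exists (fun l => if lift j l == i then q i `&` q j else q (lift j l)); split.
    by move=> l; case: eqP => // _; apply: GI.
  rewrite Iq; apply/seteqP; split=> [x qx l _|x qx l _].
    by case: eqP => _; [split|]; apply: qx.
  have qij : q i x /\ q j x.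
    have [l' il'|ij] := unliftP j i; last by case: neq.
    by have := qx l' Logic.I; rewrite -il' eqxx.
  have [l' ll'|->] := unliftP j l; last by case: qij.
  by have := qx l' Logic.I; rewrite -ll'; case: eqP => [->|_ //]; case: qij.
- move=> j jred; case: k => [|k] in q Gq Iq kmin j jred *; first by case: j {jred}.
  suff /kmin : S k by rewrite ltnn.
  apply/asboolP; exists (fun l => q (lift j l)); split=> //.
  rewrite Iq; apply/seteqP; split=> [x qx l _|x qx]; first exact: qx.
  have qx' l : l <> j -> q l x.
    have [l' -> _|->//] := unliftP j l; exact: qx.
  move=> l _; have [->|/eqP/qx'//] := eqVneq l j.
  by apply: jred => l' /qx'.
Qed.

Lemma has_minimal_primary_decomposition I : has_primary_decomposition I ->
  exists k (q : 'I_k -> set R), minimal_primary_decomposition I q.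
Proof.
move=> [k [q [qpr Iq]]].
have [|k' [q' [minq' _]]] :=
  @exists_minimal_primary_decomposition (@is_primary R) I k q (fun _ => id) _ qpr Iq.
  exact: primary_setI.
by exists k', q'.
Qed.

(** By irredundancy some [x] lies in every component except [q' i], so [radical (q' i)] is the
    radical of [(I : x)]. Computed from [q], this prime is an intersection of some [radical (q j)],
    hence equals one of them. *)
Lemma ass_sub I k (q : 'I_k -> set R) P :
  primary_decomposition I q -> ass I P -> exists i, P = radical (q i).
Proof.
move=> Iq [l [q' [[[q'pr Iq'] _ q'irr] [i ->]]]].
have /existsNP [x /not_implyP [q'x nq'x]] := q'irr i.
have Dx : [set j | ~ q' j x] = [set i].
  by apply/seteqP; split=> j /= => [nq|->//]; apply: contrapT => ji; apply: nq; apply: q'x.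
have eqr : radical (q' i) = radical [set y | I (x * y)].
  by rewrite (@colon_radical I l q') // Dx bigcap_set1.
have rpr := radical_primary_prime (q'pr i).
rewrite eqr in rpr *; have := colon_radical x Iq.
case/(prime_eq_bigcap rpr) => [j|j _ ->]; last by exists j.
by apply: radical_ideal; apply: primary_ideal; case: Iq.
Qed.

(** The element [x] certifies that [q i] cannot be omitted. As [q] itself need not be minimal, the
    certificate is carried to a minimal decomposition through the radical of [(I : x)]. *)
Lemma radical_in_ass I k (q : 'I_k -> set R) i x : primary_decomposition I q ->
  (forall j, j <> i -> q j x) -> ~ q i x -> ass I (radical (q i)).
Proof.
move=> Iq qx nqx; have [qpr Iq'] := Iq.
have Dx : [set j | ~ q j x] = [set i].
  by apply/seteqP; split=> j /= => [nq|->//]; apply: contrapT => ji; apply: nq; apply: qx.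
have eqr : radical (q i) = radical [set y | I (x * y)].
  by rewrite (@colon_radical I k q) // Dx bigcap_set1.
have [l [q' minq']] : exists k (q : 'I_k -> set R), minimal_primary_decomposition I q.
  by apply: has_minimal_primary_decomposition; exists k, q.
exists l, q'; split=> //; case: minq' => Iq2 _ _.
have rpr := radical_primary_prime (qpr i).
rewrite eqr in rpr *; have := colon_radical x Iq2.
case/(prime_eq_bigcap rpr) => [j|j _ ->]; last by exists j.
by apply: radical_ideal; apply: primary_ideal; case: Iq2.
Qed.

End NoetherianPrimary.

(** * Frobenius powers, F-closure, f-sequences and tight closure, up to tight closedness of
    primes *)

Section Frobenius.
Variables (p : nat) (R : comNzRingType) (charR : p \in [pchar R]).
Implicit Types (I J Q P X T : set R) (b : nat -> set R).

Lemma frobD n (x y : R) : (x + y) ^+ (p ^ n) = x ^+ (p ^ n) + y ^+ (p ^ n).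
Proof.
apply: exprDn_pchar; rewrite pnatX; apply/orP; left.
by rewrite pnatE // (pcharf_prime charR).
Qed.

Lemma expr_frobD m n (x : R) : x ^+ (p ^ (m + n)) = (x ^+ (p ^ m)) ^+ (p ^ n).
Proof. by rewrite -exprM expnD. Qed.

Lemma frob_gt0 n : (0 < p ^ n)%N.
Proof. by rewrite expn_gt0 (prime_gt0 (pcharf_prime charR)). Qed.

Lemma leq_frob n : (n <= p ^ n)%N.
Proof. by rewrite ltnW // ltn_expl // (prime_gt1 (pcharf_prime charR)). Qed.

Lemma frob_preimage_ideal J n : is_ideal J -> is_ideal [set x | J (x ^+ (p ^ n))].
Proof.
move=> [J0 JD JM]; split => /=.
- by rewrite expr0n; case: (p ^ n)%N (frob_gt0 n).
- by move=> x y Jx Jy; rewrite frobD; apply: JD.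
- by move=> r x Jx; rewrite exprMn; apply: JM.
Qed.

Lemma frob_power_ideal n I : is_ideal (frob_power p n I).
Proof. exact: ideal_gen_ideal. Qed.

Lemma expr_frob_power n I x : I x -> frob_power p n I (x ^+ (p ^ n)).
Proof. by move=> Ix; apply: sub_ideal_gen; exists x. Qed.

Lemma frob_power_sub n I J : is_ideal J ->
  (forall x, I x -> J (x ^+ (p ^ n))) -> frob_power p n I `<=` J.
Proof. by move=> Jid IJ; apply: ideal_gen_sub => // _ [x Ix <-]; apply: IJ. Qed.

Lemma frob_power_mono n I J : I `<=` J -> frob_power p n I `<=` frob_power p n J.
Proof.
move=> IJ; apply: frob_power_sub => [|x /IJ]; [exact: frob_power_ideal|exact: expr_frob_power].
Qed.

Lemma frob_power_sub_ideal n I J : is_ideal J -> I `<=` J -> frob_power p n I `<=` J.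
Proof.
move=> Jid IJ; apply: frob_power_sub => // x /IJ Jx.
by rewrite -(prednK (frob_gt0 n)) exprS; apply: ideal_mulr.
Qed.

Lemma expr_frob_power_frob m n I x :
  frob_power p m I x -> frob_power p (m + n) I (x ^+ (p ^ n)).
Proof.
apply: (ideal_gen_sub (frob_preimage_ideal n (frob_power_ideal (m + n) I))).
by move=> _ [y Iy <-] /=; rewrite -expr_frobD; apply: expr_frob_power.
Qed.

Lemma frob_power_frob m n I :
  frob_power p n (frob_power p m I) = frob_power p (m + n) I.
Proof.
apply/seteqP; split; apply: frob_power_sub; try exact: frob_power_ideal.
  by move=> x; apply: expr_frob_power_frob.
by move=> x Ix; rewrite expr_frobD; do 2!apply: expr_frob_power.
Qed.

Lemma frob_power0 I : is_ideal I -> frob_power p 0 I = I.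
Proof.
move=> Iid; apply/seteqP; split; first by apply: frob_power_sub.
by move=> x Ix; rewrite -[x]expr1; apply: expr_frob_power.
Qed.

Lemma frob_power_gen_sub n X J : is_ideal J ->
  (forall x, X x -> J (x ^+ (p ^ n))) -> frob_power p n (ideal_gen X) `<=` J.
Proof.
move=> Jid XJ; apply: frob_power_sub => //.
by apply: ideal_gen_sub => //; apply: frob_preimage_ideal.
Qed.

Lemma frob_power_add_sub n I J :
  frob_power p n (ideal_add I J) `<=` ideal_add (frob_power p n I) (frob_power p n J).
Proof.
have Iid := frob_power_ideal n I; have Jid := frob_power_ideal n J.
apply: frob_power_sub; first exact: ideal_add_ideal.
move=> _ [x Ix [y Jy <-]]; rewrite frobD.
exists (x ^+ (p ^ n)); first exact: expr_frob_power.
by exists (y ^+ (p ^ n)) => //; apply: expr_frob_power.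
Qed.

Lemma ideal_exp_frob_sub n I h :
  ideal_exp (frob_power p n I) h `<=` frob_power p n (ideal_exp I h).
Proof.
apply: ideal_gen_sub; first exact: frob_power_ideal.
move=> _ [x Ix <-]; elim: h x Ix => [|h IHh] x Ix.
  rewrite big_ord0 -(expr1n _ (p ^ n)%N); apply: expr_frob_power.
  by have := @prod_ideal_exp _ I 0 (fun=> 1); rewrite big_ord0; apply; case.
rewrite big_ord_recl mulrC.
apply: (ideal_gen_mul (frob_power_ideal n _) _ (IHh _ _) (Ix ord0)) => [_ _ [u Iu <-] [v Iv <-]|i].
  by rewrite -exprMn; apply: expr_frob_power; apply: ideal_exp_mulr.
exact: Ix.
Qed.

Lemma F_closure_ideal I : is_ideal (F_closure p I).
Proof.
split.
- by exists 0%N; rewrite expr1; case: (frob_power_ideal 0 I).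
- move=> x y [m Ix] [n Iy]; exists (m + n)%N; rewrite frobD.
  case: (frob_power_ideal (m + n) I) => _ + _; apply.
    by rewrite expr_frobD; apply: expr_frob_power_frob.
  by rewrite addnC expr_frobD; apply: expr_frob_power_frob.
- move=> r x [n Ix]; exists n; rewrite exprMn.
  by case: (frob_power_ideal n I) => _ _; apply.
Qed.

Lemma sub_F_closure I : I `<=` F_closure p I.
Proof. by move=> x Ix; exists 0%N; apply: expr_frob_power. Qed.

Lemma F_closure_closed I : F_closed p (F_closure p I).
Proof.
apply/seteqP; split; first exact: sub_F_closure.
move=> x [n Fx].
(* The exponent [m] depends on the element, so the test ideal collects all [y] with [y ^+ (p ^ m)]
   in [I^[p^(n+m)]] for some [m]. It contains the [p ^ n]-th powers of the elements of the
   F-closure, hence also [x ^+ (p ^ n)]. *)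
have colim_ideal : is_ideal [set y | exists m, frob_power p (n + m) I (y ^+ (p ^ m))].
  split.
  - exists 0%N; rewrite expr0n; case: (p ^ 0)%N (frob_gt0 0) => //= _ _.
    by case: (frob_power_ideal (n + 0) I).
  - move=> y z [k Iy] [l Iz]; exists (k + l)%N; rewrite frobD.
    case: (frob_power_ideal (n + (k + l)) I) => _ + _; apply.
      by rewrite addnA expr_frobD; apply: expr_frob_power_frob.
    by rewrite [(k + l)%N]addnC addnA expr_frobD; apply: expr_frob_power_frob.
  - move=> r y [m Iy]; exists m; rewrite exprMn.
    by case: (frob_power_ideal (n + m) I) => _ _; apply.
have [|m Ix] := @frob_power_sub n (F_closure p I) _ colim_ideal _ _ Fx.
  move=> y [m Iy]; exists m; rewrite -expr_frobD addnC expr_frobD.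
  exact: expr_frob_power_frob.
by exists (n + m)%N; rewrite expr_frobD.
Qed.

Lemma f_sequence_frob b n m x : f_sequence p b ->
  b (n + m)%N (x ^+ (p ^ m)) <-> b n x.
Proof.
move=> [_ bS]; elim: m => [|m IHm]; first by rewrite addn0 expr1.
by rewrite -IHm addnS -(bS (n + m)%N) /= -exprM -expnSr.
Qed.

Lemma f_sequence_frob_power b n m : f_sequence p b ->
  frob_power p m (b n) `<=` b (n + m)%N.
Proof.
move=> fb; apply: frob_power_sub => [|x]; first by case: fb.
by move/(f_sequence_frob n m x fb).
Qed.

(** If [x ^+ (p ^ m)] lies in [I^[p^m]], it lies in [b (n + m)], and an f-sequence lets one take the
    root. With [I = b n], the terms of an f-sequence are F-closed. *)
Lemma f_sequence_F_closure b n I : f_sequence p b -> I `<=` b n ->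
  F_closure p I `<=` b n.
Proof.
move=> fb Ib x [m Ix]; apply/(f_sequence_frob n m x fb).
by apply: f_sequence_frob_power => //; apply: frob_power_mono Ix.
Qed.

Lemma ring_circP (c : R) : ring_circ c <-> forall P, minimal_prime P -> ~ P c.
Proof.
split=> [cc P Pmin Pc|nP [P /= /nP //]].
by apply: cc; exists P.
Qed.

Lemma ring_circ1 : ring_circ (1 : R).
Proof. by apply/ring_circP => P [/prime1]. Qed.

Lemma ring_circM (c d : R) : ring_circ c -> ring_circ d -> ring_circ (c * d).
Proof.
move=> /ring_circP cc /ring_circP dc; apply/ring_circP => P Pmin.
by apply: prime_notM; [case: Pmin|apply: cc|apply: dc].
Qed.

Lemma ring_circX (c : R) n : ring_circ c -> ring_circ (c ^+ n).
Proof.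
move=> cc; elim: n => [|n IHn]; first exact: ring_circ1.
by rewrite exprS; apply: ring_circM.
Qed.

Lemma sub_tight_closure I : I `<=` tight_closure p I.
Proof.
move=> x Ix; exists 1; first exact: ring_circ1.
by exists 0%N => n _; rewrite mul1r; apply: expr_frob_power.
Qed.

Lemma tight_closure_mono I J : I `<=` J -> tight_closure p I `<=` tight_closure p J.
Proof.
move=> IJ x [c cc [N cx]]; exists c => //; exists N => n /cx.
exact: frob_power_mono.
Qed.

Lemma tight_closure_ideal I : is_ideal (tight_closure p I).
Proof.
split.
- exists 1; first exact: ring_circ1.
  exists 0%N => n _; rewrite mul1r expr0n; case: (p ^ n)%N (frob_gt0 n) => //= _ _.
  by case: (frob_power_ideal n I).
- move=> x y [c cc [M cx]] [d dd [N dy]]; exists (c * d); first exact: ring_circM.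
  exists (maxn M N) => n; rewrite geq_max => /andP [/cx {}cx /dy {}dy].
  rewrite frobD mulrDr; case: (frob_power_ideal n I) => _ D Mu; apply: D.
    by rewrite mulrAC mulrC; apply: Mu.
  by rewrite -mulrA; apply: Mu.
- move=> r x [c cc [N cx]]; exists c => //; exists N => n /cx {}cx.
  by rewrite exprMn mulrCA; case: (frob_power_ideal n I) => _ _; apply.
Qed.

(** The same multiplier [c] works on both sides: the condition for [x] at exponent [k + m] is the
    condition for [x ^+ (p ^ m)] at exponent [k]. *)
Lemma tight_closure_frob n m I x :
  tight_closure p (frob_power p (n + m) I) (x ^+ (p ^ m)) <->
  tight_closure p (frob_power p n I) x.
Proof.
split=> -[c cc [N cx]]; exists c => //.
  exists (N + m)%N => k lek; have lemk : (m <= k)%N by apply: leq_trans lek; apply: leq_addl.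
  have := cx (k - m)%N; rewrite leq_subRL // addnC => /(_ lek).
  by rewrite -expr_frobD !frob_power_frob -addnA subnKC.
exists N => k lek; rewrite -expr_frobD frob_power_frob -addnA -frob_power_frob.
by apply: cx; apply: leq_trans lek _; apply: leq_addl.
Qed.

Lemma tight_closure_f_sequence I :
  f_sequence p (fun n => tight_closure p (frob_power p n I)).
Proof.
split=> n; first exact: tight_closure_ideal.
apply/seteqP; split=> x /=.
  by rewrite -addn1 -{1}[p]expn1 => /tight_closure_frob.
by rewrite -addn1 -{2}[p]expn1 => tx; apply/tight_closure_frob.
Qed.

Lemma tight_closure_F_closed n I : F_closed p (tight_closure p (frob_power p n I)).
Proof.
apply/seteqP; split; first exact: sub_F_closure.
exact: (f_sequence_F_closure (n := n) (tight_closure_f_sequence I)).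
Qed.

(* The Krull intersection theorem for the powers of [P R_P], with the
   localization unfolded. *)
Lemma krull_intersection_frob P c N : noetherian R -> is_prime P ->
  (forall n, (N <= n)%N -> exists s, ~ P s /\ frob_power p n P (s * c)) ->
  exists s, ~ P s /\ s * c = 0.
Proof.
move=> noethR Ppr cP; have Pid := prime_ideal Ppr; have [P0 PD PM] := Pid.
apply: contrapT => nsc.
(* Take [Q] maximal among the ideals that contain [cP] and miss every [s * c] with [s] outside [P].
   The ideal [cP] misses them because no element outside [P] kills [c]. *)
pose T := [set s * c | s in ~` P].
pose cP' := [set r * c | r in P].
have cPid : is_ideal cP'.
  split.
  - by exists 0; rewrite ?mul0r.
  - by move=> _ _ [r Pr <-] [r' Pr' <-]; exists (r + r'); rewrite ?mulrDl //; apply: PD.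
  - by move=> z _ [r Pr <-]; exists (z * r); rewrite ?mulrA //; apply: PM.
have [|Q [Qid cPQ QT] Qmax] := @ideal_maximal_avoiding _ cP' T cPid.
  rewrite -subset0 => _ [[r Pr <-] [s nPs /eqP]]; rewrite -subr_eq0 -mulrBl => /eqP src.
  apply: nsc; exists (s - r); split=> // Psr; apply: nPs.
  by rewrite -(subrK r s); apply: PD.
have nQT s : ~ P s -> ~ Q (s * c).
  by move=> nPs Qsc; rewrite -[False]/(set0 (s * c)) -QT; split=> //; exists s.
have PQ : P `<=` radical Q.
  (* The ideals [(Q : i^n)] stabilize at some [m]. If [i ^+ m] were not in [Q], maximality would
     give [s * c = q + r * i ^+ m]; since [i * s * c] is in [cP], also [i ^+ m.+1 * r] is in [Q],
     hence [i ^+ m * r], and [s * c] would be in [Q]. *)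
  move=> i Pi.
  have [||m mP] := @chain_stabilizes R (fun n => [set y | Q (i ^+ n * y)]) noethR.
  - by move=> n; apply: colon_ideal.
  - by move=> n y /=; rewrite exprS -mulrA; case: Qid => _ _; apply.
  exists m; apply: contrapT => nQ.
  pose Q' := ideal_add Q [set r * i ^+ m | r in [set: R]].
  have Q'id : is_ideal Q' := ideal_add_ideal Qid (principal_ideal _).
  have [z [[q Qq [_ [r _ <-] qr]] [s nPs sc]]] : Q' `&` T !=set0.
    apply/set0P/eqP => Q'T; apply: nQ; rewrite -(Qmax Q') //.
      by apply: ideal_add_subr => //; exists 1; rewrite ?mul1r.
    by apply: ideal_add_subl; apply: principal_ideal.
  apply: (nQT s) => //; rewrite sc -qr; case: (Qid) => _ QD QM; apply: QD => //.
  rewrite mulrC; apply: (mP m.+1) => /=.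
  have -> : i ^+ m.+1 * r = i * (s * c) - i * q.
    by rewrite sc -qr mulrDr addrAC subrr add0r exprS -mulrA [r * _]mulrC.
  apply: idealB => //; last exact: QM.
  by apply: cPQ; exists (i * s); rewrite ?mulrA //; apply: ideal_mulr.
have [h hP] := ideal_exp_sub_radical noethR Pid Qid PQ.
(* The exponent [n = maxn N h] has [p ^ n >= h], so [P^[p^n]] lies in [Q], which would then contain
   [s * c]. *)
have [s [nPs]] := cP (maxn N h) (leq_maxl _ _).
apply: contra_not (nQT s nPs); apply: frob_power_sub => // x Px.
have leh := leq_trans (leq_maxr N h) (leq_frob (maxn N h)).
by apply: (hP _ leh); apply: expr_ideal_exp.
Qed.

(** A minimal prime inside [P] contains [s * c = 0] but not [s], hence it contains [c]. *)
Lemma ring_circ_torsion P (c s : R) : is_prime P -> ~ P s -> s * c = 0 -> ~ ring_circ c.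
Proof.
move=> Ppr nPs sc0 /ring_circP cc; have [P0 Pmin P0P] := minimal_prime_below Ppr.
apply: (cc P0) => //; have [P0pr _] := Pmin.
have : P0 (s * c) by rewrite sc0; case: (prime_ideal P0pr).
by case: P0pr => _ /[apply] -[/P0P|].
Qed.

(** For [x] outside [P], the powers [x ^+ (p ^ n)] stay outside [P] and carry [c] into [P^[p^n]];
    Krull's theorem then kills [c] by an element outside [P], so [c] lies in a minimal prime. *)
Lemma tight_closure_prime P : noetherian R -> is_prime P -> tight_closure p P `<=` P.
Proof.
move=> noethR Ppr x [c cc [N cx]]; apply: contrapT => nPx.
have [n leNn|s [nPs sc0]] := @krull_intersection_frob P c N noethR Ppr.
  by exists (x ^+ (p ^ n)); rewrite mulrC; split; [apply: prime_notX|apply: cx].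
exact: (ring_circ_torsion Ppr nPs sc0 cc).
Qed.

End Frobenius.

(** * Saturation of an ideal at a prime *)

Section Saturation.
Variable R : comNzRingType.
Implicit Types (I J Q P : set R).

(** For an ideal [I] and a prime [P] this is the contraction of the extension of [I] to the
    localization at [P], written inside [R] and hence the same for every model of the
    localization. *)
Definition saturation P I : set R := [set r | exists s, ~ P s /\ I (s * r)].

Lemma saturation_ideal P I : is_prime P -> is_ideal I -> is_ideal (saturation P I).
Proof.
move=> Ppr [I0 ID IM]; split.
- by exists 1; rewrite mulr0; split=> //; apply: prime1.
- move=> x y [s [nPs Isx]] [t [nPt Ity]]; exists (s * t).
  split; first exact: prime_notM.
  by rewrite mulrDr; apply: ID; [rewrite mulrAC mulrC|rewrite -mulrA]; apply: IM.
- by move=> r x [s [nPs Isx]]; exists s; rewrite mulrCA; split=> //; apply: IM.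
Qed.

Lemma sub_saturation P I : is_prime P -> I `<=` saturation P I.
Proof. by move=> Ppr x Ix; exists 1; rewrite mul1r; split=> //; apply: prime1. Qed.

Lemma saturation_sub_primary P I Q : is_primary_to P Q -> I `<=` Q ->
  saturation P I `<=` Q.
Proof.
by move=> [[_ Qpr] <-] IQ x [s [nPs /IQ]]; rewrite mulrC => /Qpr [].
Qed.

Lemma prime_primary_to P : is_prime P -> is_primary_to P P.
Proof.
move=> Ppr; have rP : radical P = P.
  by apply/seteqP; split=> [x [n /(primeX Ppr)]|]; last exact: sub_radical.
by split=> //; split; [case: Ppr|rewrite rP; case: Ppr].
Qed.

Lemma saturation_saturation P I : is_prime P ->
  saturation P (saturation P I) = saturation P I.
Proof.
move=> Ppr; apply/seteqP; split; last exact: sub_saturation.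
move=> x [s [nPs [t [nPt Ix]]]]; exists (t * s); rewrite -mulrA.
by split=> //; apply: prime_notM.
Qed.

(** Given [x * y] in [I], saturation cancels [y] if it lies outside [P], and otherwise [y] is in the
    radical of [I]. *)
Lemma saturated_primary P I : is_prime P -> is_ideal I ->
  saturation P I `<=` I -> P `<=` radical I -> I `<=` P -> is_primary_to P I.
Proof.
move=> Ppr Iid satI PrI IP.
have rI : radical I = P.
  by apply/seteqP; split=> // x [n /IP /(primeX Ppr)].
split=> //; split.
  by split=> //; apply/proper_idealP => // /IP; apply: prime1.
move=> x y Ixy; have [Py|nPy] := pselect (P y); first by right; apply: PrI.
by left; apply: satI; exists y; rewrite mulrC.
Qed.

Lemma saturation_primary P I : is_prime P -> is_ideal I ->
  P `<=` radical I -> I `<=` P -> is_primary_to P (saturation P I).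
Proof.
move=> Ppr Iid PrI IP; apply: saturated_primary => //.
- exact: saturation_ideal.
- by rewrite saturation_saturation.
- by move=> x /PrI; apply: radical_mono; apply: sub_saturation.
- exact: (saturation_sub_primary (prime_primary_to Ppr)).
Qed.

(** Denominators may be raised to the power [p ^ n]. Hence Frobenius powers of the saturation lie in
    the saturation of [I^[p^n]], and a denominator [s] for [x ^+ (p ^ n)] puts [s * x] in the
    F-closure of [I]. *)
Lemma saturation_F_closed p P I : p \in [pchar R] -> is_prime P -> is_ideal I ->
  F_closed p I -> F_closed p (saturation P I).
Proof.
move=> charR Ppr Iid IF; apply/seteqP; split; first exact: sub_F_closure.
move=> x [n Sx].
suff [s [nPs Isx]] : saturation P (frob_power p n I) (x ^+ (p ^ n)).
  exists s; split=> //; rewrite IF; exists n; rewrite exprMn.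
  have -> : s ^+ (p ^ n) * x ^+ (p ^ n) = s ^+ (p ^ n).-1 * (s * x ^+ (p ^ n)).
    by rewrite mulrA -exprSr prednK // (frob_gt0 charR).
  by case: (frob_power_ideal p n I) => _ _; apply.
move: Sx; apply: frob_power_sub; first exact/saturation_ideal/frob_power_ideal.
move=> y [s [nPs Isy]]; exists (s ^+ (p ^ n)); split; first exact: prime_notX.
by rewrite -exprMn; apply: expr_frob_power.
Qed.

Lemma saturation_f_sequence p P (b : nat -> set R) : p \in [pchar R] -> is_prime P ->
  f_sequence p b -> f_sequence p (fun n => saturation P (b n)).
Proof.
move=> charR Ppr fb; have [bid bS] := fb.
split=> n; first exact: saturation_ideal.
apply/seteqP; split=> x [s [nPs bsx]].
  exists s; split=> //; rewrite -bS /= exprMn.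
  have -> : s ^+ p * x ^+ p = s ^+ p.-1 * (s * x ^+ p).
    by rewrite mulrA -exprSr prednK // (prime_gt0 (pcharf_prime charR)).
  by case: (bid n.+1) => _ _; apply.
exists (s ^+ p); split; first exact: prime_notX.
by rewrite -exprMn -[b n.+1 _]/(((fun r : R => r ^+ p) @^-1` b n.+1) _) bS.
Qed.

End Saturation.

(** * Extension and contraction along the localization at a prime *)

Section Localization.
Variables (R L : comNzRingType) (P : set R) (phi : {rmorphism R -> L}).
Hypotheses (Ppr : is_prime P) (locL : is_localization P phi).

(** Common denominators: the fractions with numerator in [I] form an ideal of [L] containing the
    image of [I]. *)
Lemma extension_fraction (I : set R) y : is_ideal I -> extension phi I y ->
  exists r s, [/\ ~ P s, I r & y * phi s = phi r].
Proof.
move=> [I0 ID IM] Iy; case: locL => _ frac _.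
suff fid : is_ideal [set y | exists r s, [/\ ~ P s, I r & y * phi s = phi r]].
  apply: (ideal_gen_sub fid) Iy => _ [r Ir <-]; exists r, 1.
  by rewrite rmorph1 mulr1; split=> //; apply: prime1.
split.
- by exists 0, 1; rewrite mul0r rmorph0; split=> //; apply: prime1.
- move=> u v [r [s [nPs Ir us]]] [r' [s' [nPs' Ir' vs]]].
  exists (s' * r + s * r'), (s * s'); split.
  + exact: prime_notM.
  + by apply: ID; apply: IM.
  + rewrite rmorphD !rmorphM mulrDl mulrA us -vs.
    by congr (_ + _); [rewrite mulrC|rewrite mulrCA].
- move=> u v [r [s [nPs Ir vs]]].
  have [r' [s' [nPs' us]]] := frac u.
  exists (r' * r), (s' * s); split; [exact: prime_notM|exact: IM|].
  by rewrite !rmorphM mulrACA us vs.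
Qed.

Lemma contraction_extension (I : set R) : is_ideal I ->
  contraction phi (extension phi I) = saturation P I.
Proof.
move=> Iid; have [I0 ID IM] := Iid; have [unit _ tors] := locL.
apply/seteqP; split=> x /=.
  move=> /(extension_fraction Iid) [r [s [nPs Ir /eqP]]].
  (* Equality in [L] only gives an equality in [R] after multiplication by some [t] outside [P], so
     the denominator becomes [t * s]. *)
  rewrite -rmorphM -subr_eq0 -rmorphB => /eqP /tors [t [nPt /eqP]].
  rewrite mulrBr subr_eq0 => /eqP txs.
  exists (t * s); split; first exact: prime_notM.
  by rewrite -mulrA [s * x]mulrC txs; apply: IM.
move=> [s [nPs Isx]]; have [u su] := unit s nPs; rewrite /contraction /=.
have -> : phi x = u * phi (s * x) by rewrite rmorphM mulrA [u * _]mulrC su mul1r.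
case: (ideal_gen_ideal (phi @` I)) => _ _; apply.
by apply: sub_ideal_gen; exists (s * x).
Qed.

Lemma contraction_ideal (J : set L) : is_ideal J -> is_ideal (contraction phi J).
Proof.
move=> [J0 JD JM]; split; rewrite /contraction /=.
- by rewrite rmorph0.
- by move=> x y Jx Jy; rewrite rmorphD; apply: JD.
- by move=> r x Jx; rewrite rmorphM; apply: JM.
Qed.

Lemma contraction_saturated (J : set L) : is_ideal J ->
  saturation P (contraction phi J) `<=` contraction phi J.
Proof.
move=> [_ _ JM] x [s [nPs Jsx]]; have [unit _ _] := locL.
have [u su] := unit s nPs; rewrite /contraction /=.
have -> : phi x = u * phi (s * x) by rewrite rmorphM mulrA [u * _]mulrC su mul1r.
exact: JM.
Qed.

Lemma extension_mem (I : set R) x : I x -> extension phi I (phi x).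
Proof. by move=> Ix; apply: sub_ideal_gen; exists x. Qed.

Lemma frob_power_extension p n (I : set R) : p \in [pchar L] ->
  frob_power p n (extension phi I) = extension phi (frob_power p n I).
Proof.
move=> charL; apply/seteqP; split.
  apply: frob_power_gen_sub => //; first exact: ideal_gen_ideal.
  by move=> _ [x Ix <-]; rewrite -rmorphXn; apply: extension_mem; apply: expr_frob_power.
apply: ideal_gen_sub; first exact: frob_power_ideal.
move=> _ [x Ix <-]; move: x Ix; apply: ideal_gen_sub.
  by apply: contraction_ideal; apply: frob_power_ideal.
move=> _ [x Ix <-] /=; rewrite /contraction /= rmorphXn.
by apply: expr_frob_power; apply: extension_mem.
Qed.

End Localization.

(** * Subrings, quotients and factorizations, as tools for constructing rings *)

Section Subring.
Variables (S : comNzRingType) (A : set S).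
Hypotheses (A1 : A 1) (AB : forall x y, A x -> A y -> A (x - y)).
Hypothesis AM : forall x y, A x -> A y -> A (x * y).

(** The closure proofs are phantom arguments: the term itself carries the facts on which the
    algebraic instances declared for it rest. *)
Definition subring_pred of A 1 & (forall x y, A x -> A y -> A (x - y))
  & (forall x y, A x -> A y -> A (x * y)) : {pred S} := fun x => `[< A x >].

Fact subring_pred_closed : subring_closed (subring_pred A1 AB AM).
Proof.
split=> [|x y /asboolP Ax /asboolP Ay|x y /asboolP Ax /asboolP Ay]; apply/asboolP => //.
- exact: AB.
- exact: AM.
Qed.

HB.instance Definition _ :=
  GRing.isSubringClosed.Build S (subring_pred A1 AB AM) subring_pred_closed.

Definition subring_of := {x : S | subring_pred A1 AB AM x}.
HB.instance Definition _ := SubChoice.on subring_of.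
HB.instance Definition _ := [SubChoice_isSubComNzRing of subring_of by <:].

Lemma exists_subring : exists (T : comNzRingType) (incl : {rmorphism T -> S}),
  injective incl /\ range incl = A.
Proof.
exists subring_of, (val : {rmorphism subring_of -> S}); split; first exact: val_inj.
apply/seteqP; split=> [_ [x _ <-]|x Ax]; first exact/asboolP/(valP x).
have Ax' : subring_pred A1 AB AM x by apply/asboolP.
by exists (Sub x Ax').
Qed.

End Subring.

Section Quotient.
Variables (S : comNzRingType) (I : set S) (Iid : is_ideal I) (nI1 : ~ I 1).

Definition ideal_pred of is_ideal I & ~ I 1 : {pred S} := fun x => `[< I x >].

Fact ideal_pred_closed : idealr_closed (ideal_pred Iid nI1).
Proof.
have [I0 ID IM] := Iid; split.
- exact/asboolP.
- by apply/negP => /asboolP.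
- by move=> r x y /asboolP Ix /asboolP Iy; apply/asboolP/ID => //; apply: IM.
Qed.

HB.instance Definition _ := isIdealr.Build S (ideal_pred Iid nI1) ideal_pred_closed.

Lemma exists_quotient : exists (T : comNzRingType) (pr : {rmorphism S -> T}),
  range pr = setT /\ forall x, pr x = 0 <-> I x.
Proof.
pose T : comNzRingType := {ideal_quot (ideal_pred Iid nI1)}.
exists T, (\pi_T : {rmorphism S -> T})%qT; split.
  by apply/seteqP; split=> // x _; exists (repr x)%qT => //; exact: reprK.
pose pr := (\pi_T : {rmorphism S -> T})%qT.
move=> x; have := Quotient.idealrBE (ideal_pred Iid nI1) x 0; rewrite subr0.
have -> : (x == 0 %[mod T])%qT = (pr x == 0) by rewrite -(rmorph0 pr).
move=> E; split=> [/eqP|Ix]; first by rewrite -E => /asboolP.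
by apply/eqP; rewrite -E; apply/asboolP.
Qed.
End Quotient.

Lemma surjective_bijective (A B : Type) (f : A -> B) :
  injective f -> (forall y, exists x, f x = y) -> bijective f.
Proof.
by move=> finj /choice [g fg]; exists g => // x; apply: finj; rewrite fg.
Qed.

(** Injectivity of [i] makes the chosen preimages compatible with the ring operations. *)
Lemma rmorphism_factor (Q T S : comNzRingType) (i : {rmorphism T -> S})
    (g : {rmorphism Q -> S}) : injective i -> range g `<=` range i ->
  exists f : {rmorphism Q -> T}, forall x, i (f x) = g x.
Proof.
move=> inj gi; have /choice [f fP] (x : Q) : exists y, i y = g x.
  by have [y _ <-] := gi (g x) (imageT g x); exists y.
have fB : zmod_morphism f by move=> x y; apply: inj; rewrite rmorphB !fP rmorphB.
have fM : monoid_morphism f.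
  by split=> [|x y]; apply: inj; rewrite ?(rmorph1, rmorphM) ?fP ?(rmorph1, rmorphM).
pose F : {rmorphism Q -> T} := HB.pack f (GRing.isZmodMorphism.Build Q T f fB)
  (GRing.isMonoidMorphism.Build Q T f fM).
by exists F.
Qed.

Lemma frobB p (S : comNzRingType) n (x y : S) : p \in [pchar S] ->
  (x - y) ^+ (p ^ n) = x ^+ (p ^ n) - y ^+ (p ^ n).
Proof. by move=> charS; apply/eqP; rewrite eq_sym subr_eq -frobD // subrK. Qed.

(** * A perfect ring in which only nilpotent elements of [R] vanish *)

Section FrobeniusColimit.
Variables (p : nat) (R : comNzRingType) (charR : p \in [pchar R]).

Definition eventually_frob : set (nat -> R) :=
  [set u | exists N, forall m, (N <= m)%N -> u m.+1 = u m ^+ p].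

(* On sequences with [u m.+1 = u m ^+ p] the Frobenius is the shift, which is
   invertible once eventually equal sequences are identified. *)
Lemma exists_frob_colimit : exists (S : comNzRingType) (f : {rmorphism R -> S}),
  perfect p S /\ forall r, f r = 0 -> exists n, r ^+ (p ^ n) = 0.
Proof.
have FrobB (x y : R) : (x - y) ^+ p = x ^+ p - y ^+ p.
  by have := frobB 1 x y charR; rewrite expn1.
have [|||T [i [iinj iT]]] := @exists_subring (nat -> R) eventually_frob.
- by exists 0%N => m _; rewrite /GRing.one /= expr1n.
- move=> u v [M uM] [N vN]; exists (maxn M N) => m; rewrite geq_max => /andP [/uM uS /vN vS].
  by rewrite !fctE uS vS FrobB.
- move=> u v [M uM] [N vN]; exists (maxn M N) => m; rewrite geq_max => /andP [/uM uS /vN vS].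
  by rewrite !fctE uS vS exprMn.
have iD x y m : i (x + y) m = i x m + i y m by rewrite rmorphD.
have iB x y m : i (x - y) m = i x m - i y m by rewrite rmorphB.
have iM x y m : i (x * y) m = i x m * i y m by rewrite rmorphM.
have i1 m : i 1 m = 1 by rewrite rmorph1.
have iXE x n m : i (x ^+ n) m = (i x m) ^+ n.
  by elim: n => [|n IHn]; rewrite ?i1 // !exprS iM IHn.
(* Modulo eventually zero sequences; the class of [m |-> r ^+ (p ^ m)] will be the image of [r]. *)
pose I : set T := [set x | exists N, forall m, (N <= m)%N -> i x m = 0].
have Iid : is_ideal I.
  split.
  - by exists 0%N => m _; rewrite rmorph0.
  - move=> x y [M xM] [N yN]; exists (maxn M N) => m; rewrite geq_max => /andP [/xM x0 /yN y0].
    by rewrite iD x0 y0 addr0.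
  - by move=> r x [N xN]; exists N => m /xN x0; rewrite iM x0 mulr0.
have nI1 : ~ I 1.
  move=> [N /(_ N (leqnn N)) /eqP].
  by rewrite i1 oner_eq0.
have [S [pr [prS prI]]] := exists_quotient Iid nI1.
pose g (r : R) (m : nat) := r ^+ (p ^ m).
have gB : zmod_morphism g by move=> x y; apply/funext => m; rewrite /g fctE frobB.
have gM : monoid_morphism g.
  by split=> [|x y]; apply/funext => m; rewrite /g ?fctE ?expr1n ?exprMn.
pose G : {rmorphism R -> (nat -> R)} := HB.pack g
  (GRing.isZmodMorphism.Build R (nat -> R) g gB)
  (GRing.isMonoidMorphism.Build R (nat -> R) g gM).
have [|f fG] := @rmorphism_factor R T _ i G iinj.
  move=> _ [r _ <-]; rewrite iT; exists 0%N => m _.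
  by rewrite /= /g -exprM -expnSr.
exists S, (pr \o f : {rmorphism R -> S}); split; last first.
  move=> r /= /prI [N /(_ N (leqnn N))]; rewrite fG => rN; by exists N.
have iE x : exists N, forall m, (N <= m)%N -> i x m.+1 = i x m ^+ p.
  by have : eventually_frob (i x) by rewrite -iT; exists x.
have charS : p \in [pchar S] := rmorph_pchar (pr \o f : {rmorphism R -> S}) charR.
split=> //; apply: surjective_bijective => [x y|y].
  have [x' _ <-] : range pr x by rewrite prS.
  have [y' _ <-] : range pr y by rewrite prS.
  have [M xM] := iE x'; have [N yN] := iE y'.
  move=> /eqP; rewrite -subr_eq0 -!rmorphXn -rmorphB => /eqP /prI [K eqK].
  apply/eqP; rewrite -subr_eq0 -rmorphB; apply/eqP/prI.
  exists (maxn K (maxn M N)).+1 => -[//|m]; rewrite ltnS !geq_max => /and3P [leK leM leN].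
  by have := eqK m leK; rewrite !iB !iXE -xM // -yN.
have [x _ <-] : range pr y by rewrite prS.
have [N xN] := iE x.
(* The backward shift of [x] is a [p]-th root of its class; the entry at index 0 is immaterial. *)
have [z _ zP] : range i (fun m => i x m.-1).
  rewrite iT; exists N.+1 => -[//|m]; rewrite ltnS => leN /=.
  exact: xN.
exists (pr z); apply/eqP; rewrite -subr_eq0 -rmorphXn -rmorphB; apply/eqP/prI.
exists N.+1 => -[//|m]; rewrite ltnS => leN.
by rewrite iB iXE zP /= xN // subrr.
Qed.

End FrobeniusColimit.

(** * The maps [psi_n] and the correspondence between f-sequences and ideals of the perfect
    closure *)

Section PerfectClosure.
Variables (p : nat) (R Rinf : comNzRingType) (psi0 : {rmorphism R -> Rinf}).
Hypotheses (charR : p \in [pchar R]) (perfR : is_perfect_closure p psi0).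

Lemma perfect_root (S : comNzRingType) n (x : S) : perfect p S ->
  exists y, y ^+ (p ^ n) = x.
Proof.
move=> [_ [g _ gK]]; elim: n x => [|n IHn] x; first by exists x; rewrite expr1.
by have [y yx] := IHn (g x); exists y; rewrite expnSr exprM yx gK.
Qed.

Lemma perfect_inj (S : comNzRingType) n : perfect p S ->
  injective (fun x : S => x ^+ (p ^ n)).
Proof.
move=> [_ [g gK _]]; elim: n => [|n IHn] x y; first by rewrite !expr1.
by rewrite expnSr !exprM => /(can_inj gK) /IHn.
Qed.

Let charI : p \in [pchar Rinf]. Proof. by case: perfR => -[]. Qed.
Let perfI : perfect p Rinf. Proof. by case: perfR. Qed.

Lemma psi_root n r : psi p psi0 n r ^+ (p ^ n) = psi0 r.
Proof.
have [y yr] := perfect_root n (psi0 r) perfI.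
exact: (xgetI 0 (yr : [set x : Rinf | x ^+ (p ^ n) = psi0 r] y)).
Qed.

Lemma psi_eq n r x : x ^+ (p ^ n) = psi0 r -> x = psi p psi0 n r.
Proof. by rewrite -(psi_root n) => /(perfect_inj perfI). Qed.

(** The elements having some [p ^ n]-th power in the image of [psi0] form a perfect subring.
    Universality maps [Rinf] into it over [R], and by uniqueness the composite with the inclusion is
    the identity, so the subring is all of [Rinf]. *)
Lemma psi_surj x : exists n r, x = psi p psi0 n r.
Proof.
pose A := [set x : Rinf | exists n r, x ^+ (p ^ n) = psi0 r].
have [|||T [i [iinj iA]]] := @exists_subring Rinf A.
- by exists 0%N, 1; rewrite rmorph1 expr1.
- move=> u v [m [r ur]] [n [s vs]]; exists (m + n)%N, (r ^+ (p ^ n) - s ^+ (p ^ m)).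
  by rewrite rmorphB !rmorphXn frobB // {2}addnC !expr_frobD ur vs.
- move=> u v [m [r ur]] [n [s vs]]; exists (m + n)%N, (r ^+ (p ^ n) * s ^+ (p ^ m)).
  by rewrite rmorphM !rmorphXn exprMn {2}addnC !expr_frobD ur vs.
have perfT : perfect p T.
  split.
    move: charI; rewrite !inE => /andP [-> /eqP p0] /=; apply/eqP/iinj.
    by rewrite rmorph_nat rmorph0.
  apply: surjective_bijective => [u v uv|u].
    apply: iinj; apply: (@perfect_inj Rinf 1) => //.
    by rewrite /= expn1 -!rmorphXn uv.
  have [n [r ur]] : A (i u) by rewrite -iA; exists u.
  have [y yu] := perfect_root 1 (i u) perfI; rewrite expn1 in yu.
  have [z _ zy] : range i y by rewrite iA; exists n.+1, r; rewrite expnS exprM yu.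
  by exists z; apply: iinj; rewrite rmorphXn zy.
have [|f fP] := @rmorphism_factor R T Rinf i psi0 iinj.
  by move=> _ [r _ <-]; rewrite iA; exists 0%N, r; rewrite expr1.
have [_ univ] := perfR.
have [g [gf _]] := univ T f perfT.
have [h [_ huniq]] := univ Rinf psi0 perfI.
have ig : (i \o g : {rmorphism Rinf -> Rinf}) =1 h.
  by apply: huniq => r; rewrite -[RHS]fP /=; congr (i _); exact: gf.
have id_h : (idfun : {rmorphism Rinf -> Rinf}) =1 h by apply: huniq.
have [n [r xr]] : A x by rewrite -iA; exists (g x) => //; rewrite -[LHS]/((i \o g) x) ig -id_h.
by exists n, r; apply: psi_eq.
Qed.

(** The map from [R] to the Frobenius colimit factors through [psi0], and only nilpotent elements
    are in its kernel. *)
Lemma psi0_ker r : psi0 r = 0 -> exists n, r ^+ (p ^ n) = 0.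
Proof.
have [S [f [perfS fker]]] := exists_frob_colimit charR.
have [_ univ] := perfR; have [g [gf _]] := univ S f perfS.
by move=> r0; apply: fker; rewrite -gf /= r0 rmorph0.
Qed.

Lemma psi_frob n m r : psi p psi0 (n + m) (r ^+ (p ^ m)) = psi p psi0 n r.
Proof. by apply/esym/psi_eq; rewrite expr_frobD psi_root rmorphXn. Qed.

Lemma psiD n r s : psi p psi0 n (r + s) = psi p psi0 n r + psi p psi0 n s.
Proof. by apply/esym/psi_eq; rewrite frobD // !psi_root rmorphD. Qed.

Lemma psiM n r s : psi p psi0 n (r * s) = psi p psi0 n r * psi p psi0 n s.
Proof. by apply/esym/psi_eq; rewrite exprMn !psi_root rmorphM. Qed.

Lemma psiX n r k : psi p psi0 n (r ^+ k) = psi p psi0 n r ^+ k.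
Proof. by apply/esym/psi_eq; rewrite exprAC psi_root rmorphXn. Qed.

Lemma psi_0 n : psi p psi0 n 0 = 0.
Proof. by apply/esym/psi_eq; rewrite rmorph0 expr0n -leqn0 leqNgt (frob_gt0 charR). Qed.

Lemma psi_1 n : psi p psi0 n 1 = 1.
Proof. by apply/esym/psi_eq; rewrite rmorph1 expr1n. Qed.

Lemma psi_surj2 x y : exists n r s, x = psi p psi0 n r /\ y = psi p psi0 n s.
Proof.
have [m [r ->]] := psi_surj x; have [n [s ->]] := psi_surj y.
exists (m + n)%N, (r ^+ (p ^ n)), (s ^+ (p ^ m)).
by rewrite psi_frob addnC psi_frob.
Qed.

(** If [psi_m s = psi_n r], then [s ^+ (p ^ n)] and [r ^+ (p ^ m)] have the same image under [psi0],
    hence equal [p ^ k]-th powers for some [k]; in an f-sequence membership passes to and from such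
    powers. *)
Lemma f_sequence_idealP b n r : f_sequence p b ->
  f_sequence_ideal p psi0 b (psi p psi0 n r) <-> b n r.
Proof.
move=> fb; split=> [[m _ [s bs]]|br]; last by exists n => //; exists r.
rewrite -(psi_frob m n) addnC -(psi_frob n m) => eqmn.
have /eqP := congr1 (fun x => x ^+ (p ^ (n + m))) eqmn.
rewrite /= !psi_root -subr_eq0 -rmorphB => /eqP /psi0_ker [k].
rewrite frobB // => /eqP; rewrite subr_eq0 => /eqP eqk.
apply/(f_sequence_frob n (m + k) r fb).
rewrite addnA expr_frobD -eqk; apply/(f_sequence_frob _ k _ fb).
by rewrite addnC; apply/(f_sequence_frob _ n _ fb).
Qed.

Lemma f_sequence_ideal_ideal b : f_sequence p b ->
  is_ideal (f_sequence_ideal p psi0 b).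
Proof.
move=> fb; have [bid _] := fb; split.
- by rewrite -(psi_0 0); apply/f_sequence_idealP => //; case: (bid 0%N).
- move=> x y; have [n [r [s [-> ->]]]] := psi_surj2 x y.
  move=> /(f_sequence_idealP _ _ fb) br /(f_sequence_idealP _ _ fb) bs.
  by rewrite -psiD; apply/f_sequence_idealP => //; case: (bid n) => _ + _; apply.
- move=> x y; have [n [r [s [-> ->]]]] := psi_surj2 x y.
  move=> /(f_sequence_idealP _ _ fb) bs.
  by rewrite -psiM; apply/f_sequence_idealP => //; case: (bid n) => _ _; apply.
Qed.

Lemma f_sequence_ideal_primary b : f_sequence p b ->
  (forall n, is_primary (b n)) -> is_primary (f_sequence_ideal p psi0 b).
Proof.
move=> fb bpr; have Bid := f_sequence_ideal_ideal fb; split.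
  split=> //; apply/proper_idealP => //; rewrite -(psi_1 0).
  by move/(f_sequence_idealP _ _ fb); apply: primary1.
move=> x y; have [n [r [s [-> ->]]]] := psi_surj2 x y; rewrite -psiM.
move=> /(f_sequence_idealP _ _ fb); case: (bpr n) => _ /[apply] -[br|[k bs]].
  by left; apply/f_sequence_idealP.
by right; exists k; rewrite -psiX; apply/f_sequence_idealP.
Qed.

Lemma f_sequence_ideal_bigcap k (b : 'I_k -> nat -> set R) c :
  (forall i, f_sequence p (b i)) -> f_sequence p c ->
  (forall n, c n = \bigcap_i b i n) ->
  f_sequence_ideal p psi0 c = \bigcap_i f_sequence_ideal p psi0 (b i).
Proof.
move=> fb fc cb; apply/seteqP; split=> x; have [n [r ->]] := psi_surj x.
  move=> /(f_sequence_idealP _ _ fc); rewrite cb => br i _.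
  by apply/f_sequence_idealP => //; apply: br.
move=> br; apply/f_sequence_idealP => //; rewrite cb => i _.
by apply/(f_sequence_idealP _ _ (fb i)); apply: br.
Qed.

Lemma psi_preimage_f_sequence (Q : set Rinf) : is_ideal Q ->
  f_sequence p (fun n => psi p psi0 n @^-1` Q).
Proof.
move=> [Q0 QD QM]; split=> n.
  split=> [|x y|r x] /=; first by rewrite psi_0.
    by rewrite psiD; apply: QD.
  by rewrite psiM; apply: QM.
by apply/seteqP; split=> r /=; rewrite -addn1 -{1}(expn1 p) psi_frob.
Qed.

Lemma psi_preimage_primary (Q : set Rinf) n : is_primary Q ->
  is_primary (psi p psi0 n @^-1` Q).
Proof.
move=> Qpr; have [bid _] := psi_preimage_f_sequence (primary_ideal Qpr); split.
  split=> //; apply/(proper_idealP (bid n)); rewrite /= psi_1; exact: primary1.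
move=> r s /=; rewrite psiM; case: Qpr => _ /[apply] -[Qr|[k Qs]]; first by left.
by right; exists k; rewrite /= psiX.
Qed.

(** The radical is independent of [n] because [psi0 r] is the [p ^ n]-th power of [psi_n r]. *)
Lemma radical_psi_preimage (Q : set Rinf) n : is_primary Q ->
  radical (psi p psi0 n @^-1` Q) = psi0 @^-1` radical Q.
Proof.
move=> Qpr; have Qid := primary_ideal Qpr; apply/seteqP; split=> r [k].
  move=> /= Qr; exists k.
  by rewrite -(psi_root n) exprAC -psiX -(prednK (frob_gt0 charR n)) exprS; apply: ideal_mulr.
rewrite -(psi_root n) -exprM => Qr; exists (p ^ n * k)%N.
by rewrite /= psiX.
Qed.

(** Every element of [Rinf] has a power in the image of [psi0], and a prime contains an element as
    soon as it contains a power of it. *)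
Lemma prime_preimage_inj (P Q : set Rinf) : is_prime P -> is_prime Q ->
  psi0 @^-1` P = psi0 @^-1` Q -> P = Q.
Proof.
move=> Ppr Qpr eqPQ.
have memE (T : set Rinf) n r : is_prime T -> T (psi p psi0 n r) <-> (psi0 @^-1` T) r.
  move=> Tpr; rewrite /= -(psi_root n); split=> [Tr|/(primeX Tpr)//].
  by rewrite -(prednK (frob_gt0 charR n)) exprS; apply: ideal_mulr => //; apply: prime_ideal.
apply/seteqP; split=> x; have [n [r ->]] := psi_surj x.
  by move=> /(memE P n r Ppr); rewrite eqPQ => /(memE Q n r Qpr).
by move=> /(memE Q n r Qpr); rewrite -eqPQ => /(memE P n r Ppr).
Qed.

End PerfectClosure.

(** * Components pulled back from the perfect closure, and the F-closed decomposition of an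
    f-sequence *)

Section Decompositions.
Variables (p : nat) (R : comNzRingType).
Hypotheses (charR : p \in [pchar R]) (noethR : noetherian R).

Lemma f_sequence_primary_decomposition (Rinf : comNzRingType)
    (psi0 : {rmorphism R -> Rinf}) (b : nat -> set R) :
  is_perfect_closure p psi0 -> f_sequence p b ->
  has_primary_decomposition (f_sequence_ideal p psi0 b) ->
  exists k (P : 'I_k -> set R) (q : 'I_k -> nat -> set R),
    [/\ injective P, range P = \bigcup_n ass (b n),
        forall i, f_sequence p (q i), forall i n, is_primary_to (P i) (q i n)
      & forall n, b n = \bigcap_i q i n].
Proof.
move=> perfR fb /has_minimal_primary_decomposition [k [Q [[Qpr bQ] Qinj Qirr]]].
pose q i n := psi p psi0 n @^-1` Q i; pose P i := psi0 @^-1` radical (Q i).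
have bq n : b n = \bigcap_i q i n.
  apply/seteqP; split=> r; first by move=> br i _; have : (f_sequence_ideal p psi0 b)
    (psi p psi0 n r); [apply/f_sequence_idealP|rewrite bQ; apply].
  by move=> qr; apply/(f_sequence_idealP charR perfR n r fb); rewrite bQ => i _; apply: qr.
have qP i n : is_primary_to (P i) (q i n).
  by split; [apply: psi_preimage_primary|apply: radical_psi_preimage].
have qpd n : primary_decomposition (b n) (fun i => q i n).
  by split=> [i|]; [case: (qP i n)|apply: bq].
exists k, P, q; split=> //.
- move=> i j PP; apply: Qinj; apply: (prime_preimage_inj charR perfR _ _ PP);
    exact: radical_primary_prime.
- apply/seteqP; split=> [_ [i _ <-]|_ [n _ /(ass_sub (qpd n)) [i ->]]]; last first.
    by exists i => //; case: (qP i n).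
  (* Irredundancy in [Rinf] gives [x] in every [Q j] except [Q i]. Writing [x] as [psi_n r] selects
     a level [n] at which [P i] is associated to [b n], with certificate [r]. *)
  have /existsNP [x /not_implyP [Qx nQx]] := Qirr i.
  have [n [r xr]] := psi_surj perfR x; exists n => //.
  case: (qP i n) => _ <-; apply: (radical_in_ass (x := r) (qpd n)).
    by move=> j ji; rewrite /q /= -xr; apply: Qx.
  by rewrite /q /= -xr.
- by move=> i; apply: psi_preimage_f_sequence => //; apply: primary_ideal.
Qed.

Lemma F_closed_decomposition t (P : 'I_t -> set R) (q : 'I_t -> nat -> set R)
    (b : nat -> set R) :
  f_sequence p b -> (forall i, f_sequence p (q i)) ->
  (forall i n, is_primary_to (P i) (q i n)) -> (forall n, b n = \bigcap_i q i n) ->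
  exists h, (0 < h)%N /\ forall n,
    let q1 i := saturation (P i)
      (F_closure p (ideal_add (b n) (frob_power p n (ideal_exp (P i) h)))) in
    [/\ primary_decomposition (b n) q1, forall i, is_primary_to (P i) (q1 i)
      & forall i, F_closed p (q1 i)].
Proof.
move=> fb fq qP bq; have [bid _] := fb.
have Ppr i : is_prime (P i).
  by case: (qP i 0%N) => qpr <-; apply: radical_primary_prime.
have Pid i := prime_ideal (Ppr i).
have /choice [h hP] (i : 'I_t) :
    exists h, forall n, (h <= n)%N -> ideal_exp (P i) n `<=` q i 0%N.
  case: (qP i 0%N) => qpr rq; apply: ideal_exp_sub_radical => //.
    exact: primary_ideal.
  by rewrite rq.
(* The exponents [h i] come from level 0 alone, so the bound is uniform in [n]; the sum dominates
   each of them and the successor makes it positive. *)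
exists (\sum_i h i).+1; set H := (\sum_i h i).+1; split=> // n q1.
have PHq i : ideal_exp (P i) H `<=` q i 0%N.
  by apply: hP; rewrite /H (bigD1 i) //= -addnS leq_addr.
have closure_sub i :
    F_closure p (ideal_add (b n) (frob_power p n (ideal_exp (P i) H))) `<=` q i n.
  apply: f_sequence_F_closure => //; apply: ideal_add_sub.
  - by case: (fq i).
  - by rewrite bq => x; apply.
  - move=> x Px; rewrite -(add0n n); apply: f_sequence_frob_power => //.
    exact: frob_power_mono (PHq i) _ Px.
have q1q i : q1 i `<=` q i n by apply: saturation_sub_primary.
have Pexp i : P i `<=` radical
    (F_closure p (ideal_add (b n) (frob_power p n (ideal_exp (P i) H)))).
  move=> x Px; exists (H * p ^ n)%N; rewrite exprM; apply: sub_F_closure.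
  by apply: ideal_add_subr => //; apply: expr_frob_power; apply: expr_ideal_exp.
have q1P i : is_primary_to (P i) (q1 i).
  apply: saturation_primary => //; first exact: F_closure_ideal.
  by move=> x /closure_sub qx; case: (qP i n) => _ <-; apply: sub_radical.
split=> //; last first.
  by move=> i; apply: saturation_F_closed => //; [apply: F_closure_ideal|apply: F_closure_closed].
split=> [i|]; first by case: (q1P i).
apply/seteqP; split=> x; last by rewrite [b n]bq => q1x i _; apply/q1q/q1x.
move=> bx i _; apply: sub_saturation => //; apply: sub_F_closure.
by apply: ideal_add_subl => //; apply: frob_power_ideal.
Qed.

(** * Decomposition of the tight closures by means of a weak test element *)

Section TestElement.
Variables (a : set R) (b : nat -> set R) (t : nat) (P : 'I_t -> set R) (h : nat).
Hypotheses (aid : is_ideal a)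
  (ab : forall n, frob_power p n a `<=` b n)
  (btc : forall n, b n `<=` tight_closure p (frob_power p n a)).
Hypotheses (h0 : (0 < h)%N) (Ppr : forall i, is_prime (P i)) (aP : forall i, a `<=` P i).
Hypothesis bE : forall n, b n = \bigcap_i saturation (P i)
  (F_closure p (ideal_add (b n) (frob_power p n (ideal_exp (P i) h)))).

Local Notation J i := (ideal_add a (ideal_exp (P i) h)).

Let aJ i : a `<=` J i.
Proof. by apply: ideal_add_subl; apply: ideal_exp_ideal. Qed.

Let JP i : J i `<=` P i.
Proof.
have Pid := prime_ideal (Ppr i).
by apply: ideal_add_sub => //; apply: ideal_exp_sub.
Qed.

Let frobJP n i : frob_power p n (J i) `<=` P i.
Proof. by apply: frob_power_sub_ideal => //; apply: prime_ideal. Qed.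

Let PrJ n i : P i `<=` radical (frob_power p n (J i)).
Proof.
move=> x Px; exists (h * p ^ n)%N; rewrite exprM; apply: expr_frob_power.
by apply: ideal_add_subr => //; apply: expr_ideal_exp.
Qed.

(** The hypothesis on [s] follows from membership in the global components and from membership in
    the local ones, so the harder inclusion of both decompositions reduces to this lemma. *)
Lemma tight_closure_local m0 (c : R) n r : weak_test_element p m0 c ->
  (forall m i, (m0 <= m)%N -> exists s, ~ P i s /\
     frob_power p m (frob_power p n (J i)) (s * (c * r ^+ (p ^ m)))) ->
  tight_closure p (frob_power p n a) r.
Proof.
move=> [cc ct] loc.
have bcr m : (m0 <= m)%N -> b (n + m)%N (c * r ^+ (p ^ m)).
  move=> lem; rewrite bE => i _; have [s [nPs]] := loc m i lem.
  rewrite frob_power_frob // => /(frob_power_add_sub charR) Js.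
  exists s; split=> //; apply: sub_F_closure.
  exact: ideal_add_mono Js.
(* The test condition is used at exponent [k - m0] and then at exponent [m0]; the second use raises
   the first [c] to the power [p ^ m0], and the threshold [m0 + m0] leaves room for both. *)
exists (c * c ^+ (p ^ m0)); first by apply: ring_circM => //; apply: ring_circX.
exists (m0 + m0)%N => k lek.
have lem0k : (m0 <= k)%N by apply: leq_trans lek; apply: leq_addr.
have /btc : b (n + (k - m0))%N (c * r ^+ (p ^ (k - m0))).
  by apply: bcr; rewrite leq_subRL.
move=> /(ct _ (frob_power_ideal p _ a)) /(_ m0 (leqnn m0)).
by rewrite !frob_power_frob // -addnA subnK // exprMn -expr_frobD subnK // mulrA.
Qed.

Local Notation q2 n i := (saturation (P i) (tight_closure p (frob_power p n (J i)))).

Lemma tight_component_primary n i : is_primary_to (P i) (q2 n i).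
Proof.
apply: saturation_primary => //; first exact: tight_closure_ideal.
  by move=> x /(@PrJ n i); apply: radical_mono; apply: sub_tight_closure.
by move=> x /(tight_closure_mono (@frobJP n i)) /(tight_closure_prime charR noethR (Ppr i)).
Qed.

Lemma tight_component_F_closed n i : F_closed p (q2 n i).
Proof.
apply: saturation_F_closed => //; first exact: tight_closure_ideal.
exact: tight_closure_F_closed.
Qed.

Lemma tight_component_f_sequence i : f_sequence p (fun n => q2 n i).
Proof. by apply: saturation_f_sequence => //; apply: tight_closure_f_sequence. Qed.

Lemma tight_decomposition m0 (c : R) n : weak_test_element p m0 c ->
  primary_decomposition (tight_closure p (frob_power p n a)) (fun i => q2 n i).
Proof.
move=> ct; split=> [i|]; first by case: (tight_component_primary n i).
apply/seteqP; split=> r.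
  move=> tr i _; apply: sub_saturation => //; apply: tight_closure_mono tr.
  exact: frob_power_mono.
move=> q2r; apply: (tight_closure_local ct) => m i lem.
have [s [nPs]] := q2r i Logic.I; have [_ ct'] := ct.
move=> /(ct' _ (frob_power_ideal p _ _)) /(_ m lem) csr.
(* The test condition for [s * r] makes [s ^+ (p ^ m)] a denominator for [c * r ^+ (p ^ m)]. *)
by exists (s ^+ (p ^ m)); split; [apply: prime_notX|rewrite mulrCA -exprMn].
Qed.

Lemma tight_ass m0 (c : R) : weak_test_element p m0 c ->
  \bigcup_n ass (tight_closure p (frob_power p n a)) `<=` range P.
Proof.
move=> ct _ [n _ /(ass_sub (tight_decomposition n ct)) [i ->]].
by exists i => //; case: (tight_component_primary n i).
Qed.

(** For fixed [i] the components form an f-sequence of primary ideals, which corresponds to a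
    primary ideal of [Rinf]; the correspondence respects finite intersections. *)
Lemma tight_f_sequence_ideal_decomposition m0 (c : R) (Rinf : comNzRingType)
    (psi0 : {rmorphism R -> Rinf}) :
  is_perfect_closure p psi0 -> weak_test_element p m0 c ->
  has_primary_decomposition
    (f_sequence_ideal p psi0 (fun n => tight_closure p (frob_power p n a))).
Proof.
move=> perfR ct; exists t, (fun i => f_sequence_ideal p psi0 (fun n => q2 n i)); split.
  move=> i; apply: f_sequence_ideal_primary => //; first exact: tight_component_f_sequence.
  by move=> n; case: (tight_component_primary n i).
apply: f_sequence_ideal_bigcap => //.
- exact: tight_component_f_sequence.
- exact: tight_closure_f_sequence.
- by move=> n; case: (tight_decomposition n ct).
Qed.

Lemma tight_closure_proper n : a <> setT ->
  is_proper_ideal (tight_closure p (frob_power p n a)).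
Proof.
move=> aT; have tid := tight_closure_ideal charR (frob_power p n a); split=> //.
have [Q Qpr aQ] := exists_prime_above (conj aid aT); have Qid := prime_ideal Qpr.
apply/proper_idealP => //.
move=> /(tight_closure_mono (frob_power_sub_ideal charR (n := n) Qid aQ)).
by move=> /(tight_closure_prime charR noethR Qpr); apply: prime1.
Qed.

(** The growth bound holds for each component because the [h]-th power of [P i] lies in [J i]. It
    survives intersecting components of equal radical, so it passes to a minimal decomposition. *)
Lemma tight_linear_growth m0 (c : R) : a <> setT -> weak_test_element p m0 c ->
  linear_growth p h (fun n => tight_closure p (frob_power p n a)).
Proof.
move=> aT ct; split; first exact: tight_closure_f_sequence.
  by move=> n; apply: tight_closure_proper.
move=> n; have [qpr tq] := tight_decomposition n ct.
pose G := [set Q : set R | is_primary Q /\ ideal_exp (frob_power p n (radical Q)) h `<=` Q].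
have [|||k [q [qmin qG]]] := @exists_minimal_primary_decomposition
  R G _ t (fun i => q2 n i) _ _ _ tq.
- by move=> Q [].
- move=> Q Q' [Qpr QG] [Q'pr Q'G] eqr; split; first exact: primary_setI.
  rewrite radical_setI; try exact: primary_ideal.
  by rewrite -eqr setIid => x Qx; split; [apply: QG|apply: Q'G; rewrite -eqr].
- move=> i; split=> //; case: (tight_component_primary n i) => _ -> x.
  move=> /ideal_exp_frob_sub Px; apply: sub_saturation => //.
  apply: sub_tight_closure; apply: frob_power_mono Px.
  exact: ideal_add_subr.
by exists k, q; split=> // i; case: (qG i).
Qed.

(** * Components obtained from tight closures in the localizations *)

Section LocallyStable.
Variables (L : 'I_t -> comNzRingType) (phi : forall i, {rmorphism R -> L i}).
Hypothesis locL : forall i, is_localization (P i) (phi i).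
Variables (m0 : nat) (c : R).
Hypotheses (ct : weak_test_element p m0 c)
  (ctL : forall i, weak_test_element p m0 (phi i c)).

Let charL i : p \in [pchar (L i)] := rmorph_pchar (phi i) charR.

Local Notation q3 n i := (contraction (phi i)
  (tight_closure p (extension (phi i) (frob_power p n (J i))))).

(** Extension commutes with Frobenius powers and its contraction is a saturation, so the test
    condition in [L i] becomes a condition in [R] with one denominator for each [m], in the form
    used by [tight_closure_local]. *)
Lemma local_tight_closureP n i r : q3 n i r <-> forall m, (m0 <= m)%N ->
  exists s, ~ P i s /\
    frob_power p m (frob_power p n (J i)) (s * (c * r ^+ (p ^ m))).
Proof.
have [cc ct'] := ctL i.
have ctP := ct' _ (ideal_gen_ideal (phi i @` frob_power p n (J i))) (phi i r).
have E m : frob_power p m (extension (phi i) (frob_power p n (J i)))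
    (phi i c * phi i r ^+ (p ^ m)) <->
    saturation (P i) (frob_power p m (frob_power p n (J i))) (c * r ^+ (p ^ m)).
  rewrite frob_power_extension // -(contraction_extension (Ppr i) (locL i)); last first.
    exact: frob_power_ideal.
  by rewrite /contraction /= rmorphM rmorphXn.
split=> [/ctP H m /H /E //|H]; apply/ctP => m /H Hm; exact/E.
Qed.

(** For [r] outside [P i], the elements [s * r ^+ (p ^ m)] are outside [P i] and carry [c] into
    Frobenius powers of [P i]; Krull's theorem then contradicts the choice of [c]. *)
Lemma local_component_sub n i : q3 n i `<=` P i.
Proof.
move=> r /local_tight_closureP q3r; apply: contrapT => nPr.
have [cc _] := ct.
have [m lem|s [nPs sc0]] := @krull_intersection_frob p R charR (P i) c m0 noethR (Ppr i).
  have [s [nPs cr]] := q3r m lem; exists (s * r ^+ (p ^ m)); split.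
    by apply: prime_notM => //; apply: prime_notX.
  by rewrite mulrAC -mulrA; apply: frob_power_mono cr; apply: frobJP.
exact: (ring_circ_torsion (Ppr i) nPs sc0 cc).
Qed.

Lemma local_component_primary n i : is_primary_to (P i) (q3 n i).
Proof.
have tid := tight_closure_ideal (charL i) (extension (phi i) (frob_power p n (J i))).
apply: saturated_primary => //.
- exact: contraction_ideal.
- exact: contraction_saturated.
- move=> x /(@PrJ n i); apply: radical_mono => y Jy.
  by apply: sub_tight_closure; apply: extension_mem.
- exact: local_component_sub.
Qed.

Lemma local_tight_decomposition n :
  primary_decomposition (tight_closure p (frob_power p n a)) (fun i => q3 n i).
Proof.
split=> [i|]; first by case: (local_component_primary n i).
apply/seteqP; split=> r.
  move=> tr i _; apply/local_tight_closureP => m lem; exists 1; split; first exact: prime1.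
  rewrite mul1r; have [_ ct'] := ct.
  have := (ct' _ (frob_power_ideal p n a) r).1 tr m lem.
  by do 2!apply: frob_power_mono; apply: aJ.
move=> q3r; apply: (tight_closure_local ct) => m i lem.
by have /local_tight_closureP /(_ m lem) := q3r i Logic.I.
Qed.

(** The test condition is applied first in [R], to the tight closure of the contracted ideal, and
    then in [L i], to its elements; together they give the multiplier [phi i c ^+ (1 + p ^ m0)]. *)
Lemma local_component_tightly_closed n i : tightly_closed p (q3 n i).
Proof.
apply/seteqP; split; first exact: sub_tight_closure.
have [q3pr _] := local_component_primary n i; have q3id := primary_ideal q3pr.
move=> r; have [cc ct'] := ct; move=> /(ct' _ q3id) cr.
set X := extension (phi i) (frob_power p n (J i)).
have Xid : is_ideal X by apply: ideal_gen_ideal.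
have [ccL ctL'] := ctL i.
exists (phi i c * phi i c ^+ (p ^ m0)); first by apply: ring_circM => //; apply: ring_circX.
exists (m0 + m0)%N => k lek.
have lem0k : (m0 <= k)%N by apply: leq_trans lek; apply: leq_addr.
(* [K] contains the [p ^ (k - m0)]-th powers of the elements of the component, by the test condition
   in [L i] at exponent [k]; being an ideal, it contains [c * r ^+ (p ^ (k - m0))] too. *)
pose K := [set y | frob_power p k X (phi i c * phi i y ^+ (p ^ m0))].
have Kid : is_ideal K.
  have [F0 FD FM] := frob_power_ideal p k X; split; rewrite /K /=.
  - by rewrite rmorph0 expr0n -[_ == _]negbK -lt0n (frob_gt0 charR) mulr0.
  - by move=> x y; rewrite rmorphD frobD // mulrDr; apply: FD.
  - by move=> z x; rewrite rmorphM exprMn mulrCA; apply: FM.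
have lem : (m0 <= k - m0)%N by rewrite leq_subRL.
have : K (c * r ^+ (p ^ (k - m0))).
  apply: (frob_power_sub Kid _ (cr _ lem)) => y q3y; rewrite /K /=.
  by rewrite rmorphXn -expr_frobD subnK //; apply: (ctL' X Xid (phi i y)).1.
by rewrite /K /= rmorphM exprMn rmorphXn -expr_frobD subnK // mulrA.
Qed.

End LocallyStable.
End TestElement.
End Decompositions.

Theorem theorem7p13 (p : nat) (R : comNzRingType)
  (charR : p \in [pchar R]) (noethR : noetherian R)
  (Rinf : comNzRingType) (psi0 : {rmorphism R -> Rinf})
  (perfR : is_perfect_closure p psi0)
  (a : set R) (proper_a : is_proper_ideal a)
  (a_ : nat -> set R) (fseq_a : f_sequence p a_)
  (sub_a : forall n, frob_power p n a `<=` a_ n /\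
                     a_ n `<=` tight_closure p (frob_power p n a))
  (pd_a : has_primary_decomposition (f_sequence_ideal p psi0 a_)) :
  finite_set (\bigcup_n ass (a_ n)) /\
  forall (t : nat) (P : 'I_t -> set R),
  injective P -> range P = \bigcup_n ass (a_ n) ->
  forall (L : 'I_t -> comNzRingType) (phi : forall i, {rmorphism R -> L i}),
  (forall i, is_localization (P i) (phi i)) ->
  let ec i (b : set R) := contraction (phi i) (extension (phi i) b) in
  let q1 h n i :=
    ec i (F_closure p (ideal_add (a_ n) (frob_power p n (ideal_exp (P i) h)))) in
  let part_i h := forall n,
    [/\ primary_decomposition (a_ n) (q1 h n),
        (forall i, is_primary_to (P i) (q1 h n i))
      & forall i, F_closed p (q1 h n i)] in
  let tc n := tight_closure p (frob_power p n a) in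
  (exists h : nat, (0 < h)%N /\ part_i h) /\
  forall h : nat, (0 < h)%N -> part_i h ->
    ((exists m0 (c : R), weak_test_element p m0 c) ->
      let q2 n i :=
        ec i (tight_closure p (frob_power p n (ideal_add a (ideal_exp (P i) h)))) in
      [/\ (forall n,
            [/\ primary_decomposition (tc n) (q2 n),
                (forall i, is_primary_to (P i) (q2 n i))
              & forall i, F_closed p (q2 n i)])
          /\ has_primary_decomposition (f_sequence_ideal p psi0 tc),
          linear_growth p h tc /\ finite_set (\bigcup_n ass (tc n))
        & \bigcup_n ass (tc n) `<=` \bigcup_n ass (a_ n)])
    /\
    ((exists m0 (c : R), locally_stable_weak_test_element p m0 c) ->
      let q3 n i :=
        contraction (phi i)
          (tight_closure p
            (extension (phi i) (frob_power p n (ideal_add a (ideal_exp (P i) h))))) in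
      forall n,
        [/\ primary_decomposition (tc n) (q3 n),
            (forall i, is_primary_to (P i) (q3 n i))
          & forall i, tightly_closed p (q3 n i)]).
Proof.
have aid : is_ideal a by case: proper_a.
have aT : a <> setT by case: proper_a.
have ab n : frob_power p n a `<=` a_ n by case: (sub_a n).
have btc n : a_ n `<=` tight_closure p (frob_power p n a) by case: (sub_a n).
have [k [P' [q [P'inj P'ass fq qP bq]]]] :=
  f_sequence_primary_decomposition charR perfR fseq_a pd_a.
have P'pr i : is_prime (P' i).
  by case: (qP i 0%N) => qpr <-; apply: radical_primary_prime.
have aP' i : a `<=` P' i.
  case: (qP i 0%N) => _ <- x ax; apply: sub_radical.
  by have := ab 0%N x; rewrite frob_power0 // bq => /(_ ax i Logic.I).
have fin : finite_set (\bigcup_n ass (a_ n)).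
  by rewrite -P'ass; apply: finite_image; apply: finite_finset.
split=> // t P Pinj Pass L phi locL ec q1 part_i tc.
(* The given enumeration [P] and the enumeration [P'] found through the perfect closure list the
   same primes; [j] transports the properties of [P'] to [P]. *)
have /choice [j jP] (i : 'I_t) : exists j, P' j = P i.
  have [j _ ji] : range P' (P i) by rewrite P'ass -Pass; exists i.
  by exists j.
have Ppr i : is_prime (P i) by rewrite -jP.
have aP i : a `<=` P i by rewrite -jP.
have ecE i (b : set R) : is_ideal b -> ec i b = saturation (P i) b.
  by move=> bid; rewrite /ec (contraction_extension (Ppr i) (locL i)).
have q1E h n : q1 h n = fun i => saturation (P i)
    (F_closure p (ideal_add (a_ n) (frob_power p n (ideal_exp (P i) h)))).
  by apply/funext => i; rewrite /q1 ecE //; apply: F_closure_ideal.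
split.
  have [|||h [h0 hP]] := @F_closed_decomposition p R charR noethR t P
    (fun i => q (j i)) a_ fseq_a.
  - by move=> i; apply: fq.
  - by move=> i n; rewrite -jP; apply: qP.
  - move=> n; rewrite bq; apply/seteqP; split=> x qx i _; first exact: qx.
    (* Every [P' i] occurs among the [P l], so reindexing along [j] loses no component. *)
    have [l _ li] : range P (P' i) by rewrite Pass -P'ass; exists i.
    by rewrite -(P'inj _ _ (etrans (jP l) li)); apply: qx.
  by exists h; split=> // n; rewrite q1E; apply: hP.
move=> h h0 hP.
have bE n : a_ n = \bigcap_i saturation (P i)
    (F_closure p (ideal_add (a_ n) (frob_power p n (ideal_exp (P i) h)))).
  by case: (hP n) => -[_ {1}->]; rewrite q1E.
split=> [[m0 [c ct]] q2|[m0 [c [ct ctL]]] q3 n].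
  have q2E n : q2 n = fun i => saturation (P i)
      (tight_closure p (frob_power p n (ideal_add a (ideal_exp (P i) h)))).
    by apply/funext => i; rewrite /q2 ecE //; apply: tight_closure_ideal.
  have tass := tight_ass charR noethR aid ab btc h0 Ppr aP bE ct.
  split.
  - split=> [n|].
      rewrite q2E; split.
      + exact: (tight_decomposition charR noethR aid ab btc h0 Ppr aP bE n ct).
      + by move=> i; apply: tight_component_primary.
      + by move=> i; apply: tight_component_F_closed.
    exact: (tight_f_sequence_ideal_decomposition charR noethR aid ab btc h0 Ppr aP bE perfR ct).
  - split; last by apply: sub_finite_set tass _; rewrite Pass.
    exact: (tight_linear_growth charR noethR aid ab btc h0 Ppr aP bE aT ct).
  - by rewrite -Pass.
have ctL' i : weak_test_element p m0 (phi i c) by apply: ctL (Ppr i) _ _ (locL i).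
split.
- exact: (local_tight_decomposition charR noethR aid ab btc h0 Ppr aP bE locL ct ctL' n).
- by move=> i; apply: (local_component_primary charR noethR aid h0 Ppr aP locL ct ctL').
- by move=> i; apply: (local_component_tightly_closed charR noethR aid h0 Ppr aP locL ct ctL').
Qed.
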